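(* Let $n\ge 2$ and let $\tau$ be a noncrossing hypertree on $n+1$ vertices. There is a bijection between the set of special spheres containing the tree simplex $\mathrm{Simplex}(\tau)$ as a top-dimensional simplex and the set of top-dimensional tree simplices contained in the special sphere $\mathrm{Sphere}(\tau)$. In particular, when $\tau$ is a noncrossing tree, there is a bijection between the set of noncrossing trees $\sigma$ with $\mathrm{Simplex}(\tau)\subseteq \mathrm{Sphere}(\sigma)$ and the set of noncrossing trees $\sigma$ with $\mathrm{Simplex}(\sigma)\subseteq\mathrm{Sphere}(\tau)$.
   Context: Hypergraphs. A hypergraph on a finite vertex set is a set of subsets of the vertices (hyperedges), each with at least $2$ elements. A simple cycle consists of $k\ge 2$ distinct vertices $v_1,\dots,v_k$ and distinct hyperedges $e_1,\dots,e_k$ with $v_i,v_{i+1}\in e_i$ (indices mod $k$). A hyperforest is a hypergraph with no simple cycle; a hypertree is a connected hyperforest; a tree is a hypertree all of whose hyperedges have size $2$. Noncrossing. Fix a convex $(n+1)$-gon in the plane with vertices labeled $1,\dots,n+1$ clockwise. A hypergraph on these vertices is noncrossing if the convex hulls of any two distinct hyperedges meet in at most one vertex and in no other point. Hyperedge poset. If $v$ is a vertex of a noncrossing hyperforest $\tau$, the hyperedges containing $v$ are linearly ordered from left to right as seen from $v$ looking into the polygon (so $e<e'$ at $v$ iff, going clockwise around the boundary from $v$, the other vertices of $e$ precede the other vertices of $e'$). The hyperedge poset of $\tau$ is the set of hyperedges with the partial order generated by all these local linear orders. A proper ordering of $\tau$ is a linear ordering of its hyperedges that is a linear extension of its hyperedge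 poset. Noncrossing partition link $L$. This is the order complex of the lattice of noncrossing partitions of $\{1,\dots,n+1\}$ (distinct blocks have disjoint convex hulls; ordered by refinement) with its two bounding elements removed; its simplices correspond to chains of noncrossing partitions containing both bounding elements. (It carries a piecewise spherical metric, as the link of the edge joining the bounding elements in the order complex of the full lattice with edges $x<y$ of length $\sqrt{\mathrm{rank}(y)-\mathrm{rank}(x)}$ and euclidean simplices.) For any linear ordering $e_1,\dots,e_k$ of the hyperedges of a noncrossing hypertree $\tau$, let $\pi_j$ be the (noncrossing) partition of the vertex set into connected components of the hyperforest with hyperedges $e_1,\dots,e_j$. The chain $\pi_0<\dots<\pi_k$ gives a $(k-2)$-simplex of $L$. The special sphere $\mathrm{Sphere}(\tau)$ is the union of the closed simplices obtained from all $k!$ orderings (a unit sphere $\mathbb{S}^{k-2}$). The tree simplex $\mathrm{Simplex}(\tau)$ is the union of the closed simplices obtained from the proper orderings only (a spherical simplex of dimension $k-2$). The tree simplices give a simplicial structure on $L$, namely that of the noncrossing hypertree complex (the complex whose face poset is the dual of the poset of noncrossing hypertrees). For $\tau$ a noncrossing tree, $\mathrm{Simplex}(\tau)$ and $\mathrm{Sphere}(\tau)$ are called the tree chamber and the apartment labeled $\tau$. ''Top-dimensional simplex of a special sphere'' means a tree simplex of the same dimension as that sphere. *)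

(* Defs.v *)
From mathcomp Require Import all_boot all_order all_algebra.
From mathcomp Require Import boolp classical_sets functions reals convex.

Set Implicit Arguments.
Unset Strict Implicit.
Unset Printing Implicit Defensive.

Import Order.TTheory GRing.Theory Num.Theory.
Local Open Scope ring_scope.

(* The vertices labeled 1, ..., n+1 are the elements 0, ..., n of ['I_n.+1]. *)

Section Hypergraphs.
Variable n : nat.
Implicit Types (tau sigma : {set {set 'I_n.+1}}) (s : seq {set 'I_n.+1}).

Definition hypergraph tau : Prop := forall e, e \in tau -> (2 <= #|e|)%N.

(* [ordS] is the cyclic successor of ['I_k]. *)
Definition has_simple_cycle tau : Prop :=
  exists (k : nat) (v : 'I_k -> 'I_n.+1) (e : 'I_k -> {set 'I_n.+1}),
    [/\ (2 <= k)%N, injective v, injective e &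
        forall i, [/\ e i \in tau, v i \in e i & v (ordS i) \in e i]].

Definition hyperforest tau : Prop := hypergraph tau /\ ~ has_simple_cycle tau.

Definition adjacent tau : rel 'I_n.+1 :=
  fun x y => [exists e in tau, (x \in e) && (y \in e)].

Definition connected_hypergraph tau : Prop :=
  forall x y, connect (adjacent tau) x y.

Definition hypertree tau : Prop := hyperforest tau /\ connected_hypergraph tau.

Definition tree tau : Prop :=
  hypertree tau /\ forall e, e \in tau -> #|e| = 2%N.

Definition components tau : {set {set 'I_n.+1}} :=
  equivalence_partition (connect (adjacent tau)) [set: 'I_n.+1]%SET.

(* The number of steps, clockwise along the boundary of the polygon, from the
   vertex v to the vertex w. *)
Definition clockwise_dist (v w : 'I_n.+1) : nat := ((w + n.+1 - v) %% n.+1)%N.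

Definition local_lt (v : 'I_n.+1) (e f : {set 'I_n.+1}) : bool :=
  [&& v \in e, v \in f, e != f &
      [forall x in e :\ v, forall y in f :\ v,
         (clockwise_dist v x < clockwise_dist v y)%N]].

Definition hyperedge_le tau : rel {set 'I_n.+1} :=
  connect (fun e f =>
    [&& e \in tau, f \in tau & [exists v, local_lt v e f]]).

Definition ordering tau s : bool := perm_eq s (enum tau).

Definition proper_ordering tau s : bool :=
  ordering tau s &&
  [forall e in tau, forall f in tau,
     hyperedge_le tau e f ==> (index e s <= index f s)%N].

(* pi_1, ..., pi_(k-1), where pi_j is the partition into connected components
   of the first j hyperedges in the list s of length k; the bounding elements
   pi_0 and pi_k of the chain are left out. *)
Definition chain_of s : {set {set {set 'I_n.+1}}} :=
  [set components [set e in take j s] | j : 'I_(size s) & (0 < j)%N]%SET.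

Definition refines (P Q : {set {set 'I_n.+1}}) : bool :=
  [forall B in P, [exists C in Q, B \subset C]].

End Hypergraphs.

Section Polygon.
Variables (R : realType) (n : nat).
Implicit Types (p : 'I_n.+1 -> 'rV[R]_2) (tau : {set {set 'I_n.+1}}).

(* Twice the signed area of the triangle abc; it is negative exactly when
   a, b, c are in clockwise order. *)
Definition signed_area (a b c : 'rV[R]_2) : R :=
  (b 0 0 - a 0 0) * (c 0 1 - a 0 1) - (b 0 1 - a 0 1) * (c 0 0 - a 0 0).

(* p lists, in clockwise order, the vertices of a (strictly) convex polygon. *)
Definition convex_polygon p : Prop :=
  forall i j k : 'I_n.+1, (i < j < k)%N -> signed_area (p i) (p j) (p k) < 0.

Definition hull p (e : {set 'I_n.+1}) : set 'rV[R]_2 :=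
  smallest (@convex_set R 'rV[R]_2) (p @` [set` e])%classic.

Definition noncrossing p tau : Prop :=
  forall e f, e \in tau -> f \in tau -> e != f ->
    (hull p e `&` hull p f = set0)%classic \/
    exists v : 'I_n.+1, (hull p e `&` hull p f = [set p v])%classic.

Definition nc_hypertree p tau : Prop := hypertree tau /\ noncrossing p tau.

Definition nc_tree p tau : Prop := tree tau /\ noncrossing p tau.

Definition nc_partition p (P : {set {set 'I_n.+1}}) : Prop :=
  finset.partition P [set: 'I_n.+1]%SET /\
  forall B C, B \in P -> C \in P -> B != C ->
    (hull p B `&` hull p C = set0)%classic.

(* Subcomplexes of the order complex are represented by the set of all their
   simplices, the empty simplex (of dimension -1) included. *)
Definition complex := {set {set {set {set 'I_n.+1}}}}.

(* The two conditions [P != _] exclude the bounding elements of the lattice. *)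
Definition nc_partition_link p : complex :=
  [set c : {set {set {set 'I_n.+1}}} |
    [forall P in c, [&& `[< nc_partition p P >],
                        P != [set [set x] | x : 'I_n.+1] &
                        P != [set [set: 'I_n.+1]]]] &&
    [forall P in c, forall Q in c, refines P Q || refines Q P]]%SET.

Definition closed_simplex p (c : {set {set {set 'I_n.+1}}}) : complex :=
  [set d in nc_partition_link p | d \subset c]%SET.

Definition Sphere p tau : complex :=
  (\bigcup_(s : #|tau|.-tuple {set 'I_n.+1} | ordering tau s)
     closed_simplex p (chain_of s))%SET.

Definition Simplex p tau : complex :=
  (\bigcup_(s : #|tau|.-tuple {set 'I_n.+1} | proper_ordering tau s)
     closed_simplex p (chain_of s))%SET.

Definition dimension (K : complex) : int :=
  Posz (\max_(c in K) #|c|)%N - 1.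

End Polygon.

(* Main.v *)
Require Import Defs.
From mathcomp Require Import all_boot zify.

Set Implicit Arguments.
Unset Strict Implicit.
Unset Printing Implicit Defensive.

(** Fix the number [k] of hyperedges and let [R tau sigma] mean that the simplex of
    [tau] lies in the sphere of [sigma]. The theorem compares the number of
    [sigma] with [R tau sigma] and the number of [sigma] with [R sigma tau]. The
    idea is that the simplex opposite to that of [sigma] in the sphere of
    [sigma], which consists of the chains of the antiproper orderings (the reversed
    proper ones), is again the simplex of some noncrossing hypertree
    [sigma'], and that [R tau sigma] implies [R sigma' tau]. As [sigma] is
    determined by [sigma'], every [tau] has at most as many [sigma] with
    [R tau sigma] as with [R sigma tau]; both numbers have the same sum over all
    [tau], so they are equal ([card_reversed_rel]). Spheres and simplices determine
    their hypertrees among those with [k] hyperedges ([Sphere_inj],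
    [Simplex_inj]), and trees are the case [k = n] ([tree_card]).

    To see that [R tau sigma] implies [R sigma' tau], start from a proper ordering
    [t_1, ..., t_k] of [tau] and an ordering [s_1, ..., s_k] of [sigma] with the same
    chain of partitions, and sort the second one into an antiproper
    ordering by adjacent transpositions, transposing the first one along with it.
    Every pair transposed stands as in a proper ordering of [tau] and contrary to
    an antiproper ordering of [sigma], and no pair is transposed twice. Such a transposition keeps the two chains
    equal ([swap_components]): otherwise the hyperedges would attach to different
    blocks among those just merged, and since three blocks any two of which can be
    joined without crossing the third form cyclic intervals, one of the two pairs
    would be in the wrong order ([swap_touch], [hyperedge_le_gap]). In terms
    of factorizations of the long cycle, this is the fact that a positive
    permutation braid divides the half twist.

    The hypertree [sigma'] is found as follows. When hyperedges are added in
    proper order, the blocks merged by a hyperedge [e] are consecutive intervals of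
    the new block and [e] consists of their first vertices; in antiproper order it
    consists of their last vertices ([merge_interval]). Replacing last vertices by
    first vertices along an antiproper ordering of [sigma] gives a proper ordering
    of [sigma'] ([antipodeP]). This correspondence of hyperedges reverses
    the posets ([antipode_rev]), so sorting again extends it to all proper orderings
    of [sigma'] ([exists_opposite]).

    Acyclicity enters in the form that each hyperedge is a bridge between any two of
    its vertices ([bridged], [hyperforestP]), and the geometry of the polygon only
    through the cyclic order of its vertices ([crossing_hulls],
    [uncrossed_hulls]). *)

(** * Connectivity in a hypergraph *)

Section Connectivity.
Variable n : nat.
Implicit Types (X Y : {set {set 'I_n.+1}}) (e f : {set 'I_n.+1})
  (x y z a b : 'I_n.+1).

Definition conn X : rel 'I_n.+1 := connect (adjacent X).

Lemma conn_refl X x : conn X x x.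
Proof. exact: connect0. Qed.

Lemma conn_sym X x y : conn X x y = conn X y x.
Proof.
apply: sym_connect_sym => u v; rewrite /adjacent.
by apply: eq_existsb => e; rewrite [(u \in e) && _]andbC.
Qed.

Lemma conn_trans X y x z : conn X x y -> conn X y z -> conn X x z.
Proof. exact: connect_trans. Qed.

Lemma conn_edge X e x y : e \in X -> x \in e -> y \in e -> conn X x y.
Proof.
by move=> eX xe ye; apply/connect1/existsP; exists e; rewrite eX xe ye.
Qed.

Lemma conn_ind X (P : 'I_n.+1 -> Prop) x :
  P x -> (forall e y z, e \in X -> y \in e -> z \in e -> P y -> P z) ->
  forall y, conn X x y -> P y.
Proof.
move=> Px PX y /connectP[s xs ->] {y}.
elim: s x Px xs => [//|y s IH] x Px /= /andP[/existsP[e /and3P[eX xe ye]] ys].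
by apply: IH ys; apply: PX Px; eassumption.
Qed.

Lemma conn_mono X Y x y : X \subset Y -> conn X x y -> conn Y x y.
Proof.
move=> sXY; apply: (conn_ind (P := conn Y x)) => [|e u v eX ue ve xu].
  exact: conn_refl.
by apply: conn_trans xu _; apply: conn_edge ve => //; apply: (subsetP sXY).
Qed.

Lemma connU1 X e x y :
  conn (e |: X) x y ->
  conn X x y \/ exists a b, [/\ a \in e, b \in e, conn X x a & conn X b y].
Proof.
apply: (conn_ind (P := fun y => conn X x y \/ exists a b,
  [/\ a \in e, b \in e, conn X x a & conn X b y])) => {y} [|f y z].
  by left; apply: conn_refl.
case/setU1P=> [->|fX] yf zf.
  case=> [xy|[a [b [ae be xa byy]]]]; right.
    by exists y, z; split=> //; apply: conn_refl.
  by exists a, z; split=> //; apply: conn_refl.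
case=> [xy|[a [b [ae be xa byy]]]].
  by left; apply: conn_trans xy (conn_edge fX yf zf).
by right; exists a, b; split=> //; apply: conn_trans byy (conn_edge fX yf zf).
Qed.

Lemma conn_touch X e x y :
  conn (e |: X) x y -> ~~ conn X x y -> exists2 a, a \in e & conn X x a.
Proof. by case/connU1=> [->//|[a [b [ae _ xa _]]]] _; exists a. Qed.

Lemma connU1_mono X e x y : conn X x y -> conn (e |: X) x y.
Proof. exact/conn_mono/subsetU1. Qed.

Lemma connU1_edge X e x y : x \in e -> y \in e -> conn (e |: X) x y.
Proof. by apply: conn_edge; apply: setU11. Qed.

(** The blocks after adding a hyperedge only depend on the blocks before and on
    which of them the hyperedge meets. *)
Lemma connU1_le X Y e f :
  subrel (conn X) (conn Y) ->
  (forall v, v \in e -> exists2 w, w \in f & conn Y v w) ->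
  subrel (conn (e |: X)) (conn (f |: Y)).
Proof.
move=> sXY ef x y /connU1[/sXY/connU1_mono//|[a [b [ae be xa bY]]]].
have [[a' a'f aa'] [b' b'f bb']] := (ef a ae, ef b be).
apply: (@conn_trans _ a'); first exact/connU1_mono/conn_trans/aa'/sXY.
apply: (@conn_trans _ b'); first exact: connU1_edge.
by apply: connU1_mono; apply: conn_trans (sXY _ _ bY); rewrite conn_sym.
Qed.

(** This stands for a path without repeated hyperedges: the rest of the
    connection avoids its first hyperedge, so that one can argue by induction on
    the number of hyperedges. *)
Lemma conn_first X x y : conn X x y -> x != y ->
  exists p u, [/\ p \in X, x \in p, u \in p, u != x & conn (X :\ p) u y].
Proof.
have [m] := ubnP #|X|; elim: m X => // m IH X ltXm xy neq_xy.
have [p pX xp]: exists2 p, p \in X & x \in p.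
  case/connectP: xy => [[|z s] /=]; first by move=> _ eyx; rewrite eyx eqxx in neq_xy.
  by case/andP=> /existsP[p /and3P[pX xp _]] _ _; exists p.
have IHp : conn (X :\ p) x y -> exists p u,
    [/\ p \in X, x \in p, u \in p, u != x & conn (X :\ p) u y].
  case/IH=> // [|q [u [/setD1P[_ qX] xq uq nux uy]]].
    by rewrite (cardsD1 p) pX in ltXm.
  by exists q, u; split=> //; apply: conn_mono uy; rewrite setSD ?subD1set.
move: (xy); rewrite -{1}(setD1K pX) => /connU1[xy'|[a [b [_ bp _ bY]]]]; first exact: IHp.
have [ebx|nbx] := eqVneq b x.
  by apply: IHp; rewrite -{1}ebx.
by exists p, b.
Qed.

Lemma eq_components X Y :
  (components X = components Y) <-> (conn X =2 conn Y).
Proof.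
have eqv Z : {in [set: 'I_n.+1] & &, equivalence_rel (conn Z)}.
  move=> x y z _ _ _; split; first exact: conn_refl.
  by move=> xy; apply/idP/idP; apply: conn_trans; rewrite // conn_sym.
split=> [eXY x y|eXY]; last first.
  rewrite /components /equivalence_partition; apply: eq_imset => x.
  by apply/setP=> y; rewrite !inE; apply: eXY.
have := pblock_equivalence_partition (eqv X) (in_setT x) (in_setT y).
rewrite -/(components X) eXY => <-.
exact: (pblock_equivalence_partition (eqv Y) (in_setT x) (in_setT y)).
Qed.

Lemma components_partition X : partition (components X) [set: 'I_n.+1].
Proof.
apply: equivalence_partitionP => x y z _ _ _; split; first exact: conn_refl.
by move=> xy; apply/idP/idP; apply: conn_trans; rewrite // conn_sym.
Qed.

Lemma mem_components X B :
  reflect (exists x, B = [set y | conn X x y]) (B \in components X).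
Proof.
apply: (iffP imsetP) => [[x _ ->]|[x ->]]; exists x => //;
  by apply/setP=> y; rewrite !inE.
Qed.

Lemma refines_components X Y :
  refines (components X) (components Y) <-> subrel (conn X) (conn Y).
Proof.
split=> [/forallP rXY x y xy|sXY].
  have /implyP/(_ _)/existsP := rXY [set y | conn X x y].
  case=> [|C]; first by apply/mem_components; exists x.
  case/andP=> /mem_components[z ->] /subsetP sC.
  have := sC x; have := sC y; rewrite !inE xy conn_refl => /(_ isT) zy /(_ isT).
  by rewrite conn_sym => xz; apply: conn_trans zy.
apply/forallP=> B; apply/implyP=> /mem_components[x ->].
apply/existsP; exists [set y | conn Y x y]; apply/andP; split.
  by apply/mem_components; exists x.
by apply/subsetP=> y; rewrite !inE; apply: sXY.
Qed.

End Connectivity.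

(** * Noncrossing hyperforests and the hyperedge poset *)

(** Walking clockwise around the polygon from [x], one meets [y] before [z]. *)
Definition cyc (x y z : nat) : bool := [|| x < y < z, y < z < x | z < x < y].

Ltac cyc_lia :=
  repeat match goal with H : is_true (cyc _ _ _) |- _ =>
    case/or3P: H => /andP[? ?]; try (exfalso; lia) end;
  rewrite ?/cyc; lia.

(** The combinatorial form of: the diagonals [ac] and [bd] of the polygon cross
    in their interiors. *)
Definition chords_cross (a c b d : nat) : bool :=
  [&& a != c, b != a, b != c, d != a, d != c & cyc a b c != cyc a d c].

Lemma chords_crossC a c b d : chords_cross a c b d = chords_cross b d a c.
Proof.
have h (x y z t : nat) : chords_cross x y z t -> chords_cross z t x y.
  case/and5P=> nxy nzx nzy ntx /andP[nty].
  case: (boolP (cyc x z y)) (boolP (cyc x t y)) => cz [] ct //= _.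
    have {}ct : cyc y t x by move: ct; rewrite /cyc; lia.
    have c1 : cyc z y t by cyc_lia.
    have c2 : ~~ cyc z x t by cyc_lia.
    have nzt : z != t by cyc_lia.
    by rewrite /chords_cross c1 (negbTE c2) andbT nzt /=; lia.
  have {}cz : cyc y z x by move: cz; rewrite /cyc; lia.
  have c1 : cyc z x t by cyc_lia.
  have c2 : ~~ cyc z y t by cyc_lia.
  have nzt : z != t by cyc_lia.
  by rewrite /chords_cross c1 (negbTE c2) andbT nzt /=; lia.
by apply/idP/idP; apply: h.
Qed.

Lemma cyc_side (a c b d : nat) : ~~ chords_cross a c b d ->
  b != a -> b != c -> d != a -> d != c -> cyc a b c -> cyc a d c.
Proof.
move=> + ba bc da dc cb; have ac : a != c by cyc_lia.
by rewrite /chords_cross ac ba bc da dc cb /= negbK => /eqP <-.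
Qed.

Lemma chords_cross_trans (a c b d e : nat) :
  ~~ chords_cross a c b d -> ~~ chords_cross a c d e ->
  d != a -> d != c -> ~~ chords_cross a c b e.
Proof.
move=> + + da dc; rewrite /chords_cross da dc /=.
case: (a != c) (b != a) (b != c) (e != a) (e != c) => [] [] [] [] [] //=.
by rewrite !negbK => /eqP -> /eqP ->; rewrite eqxx.
Qed.

Lemma chords_crossxx (a c b : nat) : ~~ chords_cross a c b b.
Proof. by rewrite /chords_cross eqxx !andbF. Qed.

Lemma cycC (a b c : nat) : cyc a b c = cyc b c a.
Proof. by apply/idP/idP => ?; cyc_lia. Qed.

Lemma cycN (a b c : nat) : a != b -> b != c -> a != c -> ~~ cyc a b c -> cyc a c b.
Proof. by move=> ab bc ac; rewrite /cyc; lia. Qed.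

Lemma cyc_asym (a b c : nat) : cyc a b c -> ~~ cyc a c b.
Proof. by rewrite /cyc; lia. Qed.

Lemma cyc_neq (a b c : nat) : cyc a b c -> [/\ a != b, b != c & a != c].
Proof. by rewrite /cyc => H; split; lia. Qed.

Lemma cyc_trans (a b c d : nat) : cyc a b c -> cyc a c d -> cyc a b d.
Proof. by move=> *; cyc_lia. Qed.

Lemma cyc_shift (a b c d : nat) : cyc a b c -> cyc a c d -> cyc b c d.
Proof. by move=> *; cyc_lia. Qed.

Lemma ltn_clockwise_dist n (v x y : 'I_n.+1) : x != v -> y != v ->
  (clockwise_dist v x < clockwise_dist v y) = cyc v x y.
Proof.
have dE (w : 'I_n.+1) : clockwise_dist v w = if v <= w then w - v else w + n.+1 - v.
  rewrite /clockwise_dist; case: leqP => [le_vw|lt_wv].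
    by rewrite -addnBAC // modnDr modn_small //; have := ltn_ord w; lia.
  by rewrite modn_small //; have := ltn_ord v; lia.
rewrite -!val_eqE /= !dE /cyc; have := ltn_ord x; have := ltn_ord y.
by have := ltn_ord v; case: (ltngtP v x); case: (ltngtP v y); case: (ltngtP x y) => /=; lia.
Qed.

Section Noncrossing.
Variable n : nat.
Implicit Types (X Y : {set {set 'I_n.+1}}) (e f : {set 'I_n.+1})
  (x y z a b c d : 'I_n.+1).

(** The form of acyclicity that induction on hyperedges produces and consumes:
    every hyperedge is a bridge between all of its vertices. *)
Definition bridged X : Prop :=
  forall e x y, e \in X -> x \in e -> y \in e -> conn (X :\ e) x y -> x = y.

Definition uncrossed X : Prop :=
  forall e f a c b d, e \in X -> f \in X -> e != f ->
    a \in e -> c \in e -> b \in f -> d \in f -> ~~ chords_cross a c b d.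

Definition nchf X : Prop := [/\ hypergraph X, bridged X & uncrossed X].

Lemma nchf_sub X Y : X \subset Y -> nchf Y -> nchf X.
Proof.
move=> /subsetP sXY [hY bY uY]; split=> [e /sXY/hY//|e x y eX xe ye xy|].
  apply: bY (sXY _ eX) xe ye _; apply: conn_mono xy.
  by apply/setSD/subsetP.
by move=> e f a c b d /sXY eY /sXY fY; apply: uY.
Qed.

(** Two hyperedges in different blocks do not cross, so a connected set of
    hyperedges stays on one side of any chord of another block. *)
Lemma blocks_uncrossed X a c b d : uncrossed X ->
  conn X a c -> conn X b d -> ~~ conn X a b -> ~~ chords_cross a c b d.
Proof.
move=> uX ac bd nab.
have neqX u v : conn X a u -> conn X b v -> u != v :> nat.
  move=> au bv; apply: contraNN nab => /eqP/ord_inj euv.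
  by rewrite euv in au; apply: conn_trans au _; rewrite conn_sym.
have side e x y : e \in X -> x \in e -> y \in e -> conn X a x ->
    forall v, conn X b v -> ~~ chords_cross x y b v.
  move=> eX xe ye ax; have ay := conn_trans ax (conn_edge eX xe ye).
  suff: forall v, conn X b v -> conn X b v /\ ~~ chords_cross x y b v.
    by move=> H v /H[].
  apply: (conn_ind (P := fun v => conn X b v /\ ~~ chords_cross x y b v)).
    by split; [apply: conn_refl|apply: chords_crossxx].
  move=> f u v fX uf vf [bu nxb].
  have bv := conn_trans bu (conn_edge fX uf vf); split=> //.
  have nef : e != f.
    apply/eqP=> eef; suff /(neqX _ _ ax)/eqP : conn X b x by [].
    by apply: conn_trans bu (conn_edge fX uf _); rewrite -eef.
  apply: chords_cross_trans nxb (uX _ _ _ _ _ _ eX fX nef xe ye uf vf) _ _.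
    by rewrite eq_sym; apply: neqX.
  by rewrite eq_sym; apply: neqX.
suff: forall u, conn X a u -> conn X a u /\ ~~ chords_cross b d a u.
  by case/(_ c ac) => _; rewrite chords_crossC.
apply: (conn_ind (P := fun u => conn X a u /\ ~~ chords_cross b d a u)).
  by split; [apply: conn_refl|apply: chords_crossxx].
move=> f u v fX uf vf [au nxb].
have av := conn_trans au (conn_edge fX uf vf); split=> //.
have nuv := side _ _ _ fX uf vf au d bd; rewrite chords_crossC in nuv.
by apply: chords_cross_trans nxb nuv _ _; apply: neqX => //; apply: conn_refl.
Qed.

End Noncrossing.

Section HyperedgePoset.
Variable n : nat.
Implicit Types (X Y : {set {set 'I_n.+1}}) (e f p t s : {set 'I_n.+1})
  (x y z a b c d u v w : 'I_n.+1).

Lemma neq_val x y : (x != y) = (x != y :> nat).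
Proof. by []. Qed.

Lemma conn_neq X x y z : conn X x y -> ~~ conn X x z -> y != z.
Proof. by move=> xy; apply: contraNneq => <-. Qed.

Lemma local_ltP v e f : reflect
  [/\ v \in e, v \in f, e != f &
      forall x y, x \in e -> x != v -> y \in f -> y != v -> cyc v x y]
  (local_lt v e f).
Proof.
apply: (iffP and4P) => -[ve vf nef].
  move/forall_inP=> lt; split=> // x y xe xv yf yv.
  have xe' : x \in e :\ v by rewrite !inE xv.
  have yf' : y \in f :\ v by rewrite !inE yv.
  by rewrite -ltn_clockwise_dist //; apply: (forall_inP (lt x xe')).
move=> lt; split=> //; apply/forall_inP=> x /setD1P[xv xe].
by apply/forall_inP=> y /setD1P[yv yf]; rewrite ltn_clockwise_dist ?lt.
Qed.

Lemma exists_other X e v : hypergraph X -> e \in X -> exists2 x, x \in e & x != v.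
Proof.
move=> hX /hX e2; have [x] : exists x, x \in e :\ v.
  apply/set0Pn; rewrite -card_gt0; move: e2; rewrite (cardsD1 v e) => e2.
  rewrite -(ltn_add2l (v \in e)); apply: leq_ltn_trans e2.
  by case: (v \in e).
by case/setD1P=> xv xe; exists x.
Qed.

Lemma local_lt_asym X v e f :
  hypergraph X -> e \in X -> f \in X -> local_lt v e f -> ~~ local_lt v f e.
Proof.
move=> hX eX fX /local_ltP[ve vf nef lt]; apply/negP=> /local_ltP[_ _ _ gt].
have [x xe xv] := exists_other v hX eX; have [y yf yv] := exists_other v hX fX.
have /cyc_asym/negP := lt _ _ xe xv yf yv; apply; exact: gt.
Qed.

Lemma bridged_inter X e f x y : bridged X -> e \in X -> f \in X -> e != f ->
  x \in e -> x \in f -> y \in e -> y \in f -> x = y.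
Proof.
move=> bX eX fX nef xe xf ye yf; apply: (bX e) => //.
by apply: conn_edge xf yf; rewrite !inE eq_sym nef.
Qed.

(** Since hyperedges do not cross, one pair of vertices decides on which side of
    each other two hyperedges at [v] lie. *)
Lemma local_lt_pair X v e f a b : nchf X -> e \in X -> f \in X -> e != f ->
  v \in e -> v \in f -> a \in e -> b \in f -> cyc v a b -> local_lt v e f.
Proof.
case=> hX bX uX eX fX nef ve vf ae bf lt; apply/local_ltP; split=> //.
have nE x y : x \in e -> x != v -> y \in f -> x != y.
  move=> xe xv yf; apply: contraNneq xv => exy.
  by rewrite (bridged_inter bX eX fX nef xe _ ve vf) // exy.
move=> x y xe xv yf yv.
have [va ab vb] := cyc_neq lt; rewrite eq_sym -neq_val in va.
rewrite eq_sym -neq_val in vb; have nfe : f != e by rewrite eq_sym.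
have vxb : cyc v x b.
  apply: cyc_side lt => //; first exact: uX fX eX nfe vf bf ae xe.
  exact: nE.
rewrite cycC; rewrite cycC in vxb.
apply: cyc_side vxb => //; last by rewrite eq_sym; apply: nE.
  exact: uX eX fX nef xe ve bf yf.
by rewrite eq_sym; apply: nE.
Qed.

(** If the blocks of [t'] and [t] meet in a block [B] of earlier hyperedges and,
    seen from [B], a vertex of [t'] comes just before a vertex of [t], then
    [t'] lies below [t]: walking through [B] from [t'] to [t], each hyperedge is
    locally below the next one. *)
Lemma hyperedge_le_gap tau X t t' v v' c d :
  nchf tau -> X \subset tau -> t \in tau -> t' \in tau ->
  t \notin X -> t' \notin X -> t' != t ->
  v \in t -> v' \in t' -> c \in t' -> d \in t -> conn X v' v ->
  (forall x, conn X v' x -> cyc c d x) -> hyperedge_le tau t' t.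
Proof.
move=> nctau; have [htau btau utau] := nctau.
have [m] := ubnP #|X|; elim: m X t' v' c => // m IH X t' v' c ltXm sX ttau t'tau.
move=> tX t'X nt vt v't' ct' dt v'v gap.
have [ev|nv] := eqVneq v' v.
  apply/connect1/and3P; split=> //; apply/existsP; exists v.
  have := gap _ v'v; rewrite -cycC => cdv.
  by apply: (local_lt_pair (X := tau) (a := c) (b := d)) cdv; rewrite // -ev.
have [p [u [pX v'p up nuv' uv]]] := conn_first v'v nv.
have sX' : X :\ p \subset X by apply: subD1set.
have ptau : p \in tau by apply: (subsetP sX).
have np : t' != p by apply: contraNneq t'X => ->.
have v'u : conn X v' u by apply: conn_edge pX v'p up.
have cN w : conn X v' w -> [/\ w != c & w != d].
  by move=> /gap/cyc_neq[_ dw cw]; rewrite ![w == _]eq_sym.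
(* The remaining walk avoids [p], hence its block does not contain [v'] even
   after adding [t'], and it stays on one side of the chord [c v'] of [t']. *)
have blk w : conn (X :\ p) u w -> ~~ conn (t' |: X :\ p) c w.
  move=> uw; apply/negP=> cw; case/negP: nuv'; apply/eqP.
  apply: (btau p) => //; apply: (@conn_mono _ (t' |: X :\ p)).
    apply/subsetP=> f /setU1P[->|/setD1P[nfp fX]]; rewrite !inE ?np //.
    by rewrite nfp (subsetP sX).
  apply: conn_trans (connU1_mono _ uw) _; rewrite conn_sym.
  by apply: conn_trans cw; apply: connU1_edge.
have st' : uncrossed (t' |: X :\ p).
  have [] // : nchf (t' |: X :\ p).
  apply: nchf_sub nctau; apply/subsetP=> f /setU1P[->//|].
  by move=> fX; apply/(subsetP sX)/(subsetP sX').
have cdv' : cyc c d v' by apply: gap; apply: conn_refl.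
have ncv' := cN _ (conn_refl X v'); have ncv := cN _ v'v.
have cvv' : cyc c v v'.
  have [nv'c nv'd] := ncv'; have [nvc _] := ncv; have [ncd _ _] := cyc_neq cdv'.
  apply: (@cyc_side c v' d v) => //; rewrite 1?eq_sym //.
  by apply: utau t'tau ttau nt ct' v't' dt vt.
have uv' w : conn (X :\ p) u w -> conn X v' w.
  by move=> uw; apply: conn_trans v'u (conn_mono sX' uw).
have side w : conn (X :\ p) u w -> cyc c w v'.
  move=> uw; have cv' : conn (t' |: X :\ p) c v' by apply: connU1_edge.
  apply: (@cyc_side c v' v w) => //.
  - apply: blocks_uncrossed st' cv' _ (blk _ uv).
    by apply: connU1_mono; apply: conn_trans uw; rewrite conn_sym.
  - by case: ncv.
  - by rewrite eq_sym.
  - by case: (cN w (uv' w uw)).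
  - by rewrite eq_sym; apply: conn_neq cv' (blk _ uw).
apply: (@connect_trans _ _ p).
  apply/connect1/and3P; split=> //; apply/existsP; exists v'.
  apply: (local_lt_pair (X := tau) (a := c) (b := u)) => //.
  by rewrite cycC; apply: side; apply: conn_refl.
apply: (IH (X :\ p) p u v') => //; rewrite ?inE ?eqxx //.
- by rewrite (cardsD1 p) pX in ltXm.
- by apply: subset_trans sX' sX.
- by rewrite (negbTE tX) andbF.
- by apply: contraNneq tX => <-.
move=> w uw; rewrite cycC.
exact: cyc_shift (gap w (uv' w uw)) (side w uw).
Qed.

End HyperedgePoset.

Section Swap.
Variable n : nat.
Implicit Types (X Y : {set {set 'I_n.+1}}) (e f p t s : {set 'I_n.+1})
  (x y z a b c d u v w : 'I_n.+1).

Lemma block_side X a c b d : uncrossed X -> conn X a c -> conn X b d ->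
  ~~ conn X a b -> cyc a b c -> cyc a d c.
Proof.
move=> uX ac bd nab; have nad : ~~ conn X a d.
  by apply: contraNN nab => ad; apply: conn_trans ad _; rewrite conn_sym.
apply: cyc_side; first exact: (blocks_uncrossed uX ac bd nab).
- by rewrite eq_sym; apply: (conn_neq (conn_refl X a) nab).
- by rewrite eq_sym; apply: (conn_neq ac nab).
- by rewrite eq_sym; apply: (conn_neq (conn_refl X a) nad).
- by rewrite eq_sym; apply: (conn_neq ac nad).
Qed.

Lemma bridged_touch tau X e x y : bridged tau -> X \subset tau -> e \in tau ->
  e \notin X -> x \in e -> y \in e -> conn X x y -> x = y.
Proof.
move=> btau sX etau eX xe ye xy; apply: (btau e) => //.
apply: conn_mono xy; apply/subsetP=> f fX; rewrite !inE (subsetP sX) // andbT.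
by apply: contraNneq eX => <-.
Qed.

Lemma nchf_bridged X : nchf X -> bridged X. Proof. by case. Qed.
Lemma nchf_uncrossed X : nchf X -> uncrossed X. Proof. by case. Qed.
Lemma nchf_hypergraph X : nchf X -> hypergraph X. Proof. by case. Qed.

(** If [t'] met a block [B1] and [s'] another block [B2], both among the blocks
    joined by [t] and also by [s], then together with the block [C] outside
    these that [t'] and [s'] reach, they are three cyclic intervals, as any two
    of them can be joined without crossing the third: by [t'], by [s'] and by
    [t].  If the cyclic order is [B1], [C], [B2], then [t'] is below [t];
    otherwise [s'] is below [s]. *)
Lemma swap_touch tau sigma X Y t t' s s' : nchf tau -> nchf sigma ->
  t' |: (t |: X) \subset tau -> s' |: (s |: Y) \subset sigma ->
  t \notin X -> s \notin Y -> t' \notin t |: X -> s' \notin s |: Y ->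
  conn X =2 conn Y -> conn (t |: X) =2 conn (s |: Y) ->
  conn (t' |: (t |: X)) =2 conn (s' |: (s |: Y)) ->
  ~~ hyperedge_le tau t' t -> ~~ hyperedge_le sigma s' s ->
  forall v', v' \in t' -> exists2 w', w' \in s' & conn Y v' w'.
Proof.
move=> nctau ncsig sX sY tX sY' t'X s'Y eP eM eQ nle_t nle_s v' v't'.
have btau := nchf_bridged nctau; have bsig := nchf_bridged ncsig.
have /subsetP sXt := sX; have /subsetP sYt := sY.
have t'tau : t' \in tau by apply: sXt; apply: setU11.
have s'sig : s' \in sigma by apply: sYt; apply: setU11.
have ttau : t \in tau by apply: sXt; rewrite !inE eqxx orbT.
have ssig : s \in sigma by apply: sYt; rewrite !inE eqxx orbT.
have sMt : t |: X \subset tau by apply: subset_trans sX; apply: subsetU1.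
have sMs : s |: Y \subset sigma by apply: subset_trans sY; apply: subsetU1.
have [ntt' t'X'] : t' != t /\ t' \notin X.
  by move: t'X; rewrite !inE negb_or => /andP.
have [nss' s'Y'] : s' != s /\ s' \notin Y.
  by move: s'Y; rewrite !inE negb_or => /andP.
have [c ct' ncv'] := exists_other v' (nchf_hypergraph nctau) t'tau.
have nMcv' : ~~ conn (t |: X) v' c.
  apply: contraNN ncv' => v'c; apply/eqP.
  by apply: (bridged_touch btau sMt t'tau t'X) => //; rewrite conn_sym.
have Qcv' : conn (s' |: (s |: Y)) v' c by rewrite -eQ connU1_edge.
have nMcv2 : ~~ conn (s |: Y) v' c by rewrite -eM.
have [w' w's' v'w'] := conn_touch Qcv' nMcv2.
have [c2 c2s' cc2] : exists2 c2, c2 \in s' & conn (s |: Y) c c2.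
  by apply: conn_touch (_ : conn _ c v') _; rewrite conn_sym.
have [Pv'w'|nPv'w'] := boolP (conn Y v' w'); first by exists w'.
exfalso.
have nPw'v' : ~~ conn Y w' v' by rewrite conn_sym.
have w'v' : conn (s |: Y) w' v' by rewrite conn_sym.
have [v vt v'v] : exists2 v, v \in t & conn X v' v.
  by apply: conn_touch (_ : conn _ v' w') _; rewrite ?eM ?eP.
have [v2 v2t w'v2] : exists2 v, v \in t & conn X w' v.
  by apply: conn_touch (_ : conn _ w' v') _; rewrite ?eM ?eP.
have [w2 w2s v'w2] := conn_touch v'w' nPv'w'.
have [w ws w'w] := conn_touch w'v' nPw'v'.
have Pcc2 : conn X c c2.
  apply/negPn/negP => nPcc2; have [|a at' ca] := conn_touch (_ : conn (t |: X) c c2) nPcc2.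
    by rewrite eM.
  case/negP: nMcv'; rewrite conn_sym; apply: conn_trans (connU1_mono _ ca) _.
  apply: (@conn_trans _ _ v); first exact: connU1_edge.
  by rewrite conn_sym; apply: connU1_mono.
(* [t'] does not meet the block of [w'], and [s'] does not meet that of [v']. *)
have nt'w' : ~~ conn (t' |: X) v' w'.
  apply/negP=> /connU1[|[a [b [at' bt' _ bw']]]]; first by rewrite eP; apply/negP.
  case/negP: nPv'w'; rewrite -eP; suff -> : v' = b by [].
  apply: (bridged_touch btau sMt t'tau t'X) => //.
  rewrite conn_sym; apply: conn_trans (connU1_mono _ bw') _.
  by rewrite eM.
have ns'v' : ~~ conn (s' |: Y) w' v'.
  apply/negP=> /connU1[|[a [b [as' bs' _ bv']]]]; first by apply/negP.
  case/negP: nPw'v'; suff -> : w' = b by [].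
  apply: (bridged_touch bsig sMs s'sig s'Y) => //.
  by rewrite conn_sym; apply: conn_trans (connU1_mono _ bv') _.
have ut' : uncrossed (t' |: X).
  apply/nchf_uncrossed/(nchf_sub _ nctau)/(subset_trans _ sX).
  by apply/setUS/subsetU1.
have us' : uncrossed (s' |: Y).
  apply/nchf_uncrossed/(nchf_sub _ ncsig)/(subset_trans _ sY).
  by apply/setUS/subsetU1.
have ut : uncrossed (t |: X) by apply/nchf_uncrossed/(nchf_sub sMt nctau).
have Ys'c : conn (s' |: Y) w' c.
  apply: (@conn_trans _ _ c2); first exact: connU1_edge.
  by apply: connU1_mono; rewrite conn_sym -eP.
have Ys'v2 : conn (s' |: Y) w' v2 by apply: connU1_mono; rewrite -eP.
have cv2 : conn (s' |: Y) c v2 by apply: conn_trans Ys'v2; rewrite conn_sym.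
have ncv'Y x : conn Y v' x -> ~~ conn (s' |: Y) c x.
  move=> v'x; apply: contraNN ns'v' => cx; apply: conn_trans Ys'c _.
  by apply: conn_trans cx _; apply: connU1_mono; rewrite conn_sym.
have [cyc1|] := boolP (cyc c v2 v').
  case/negP: nle_t.
  apply: (hyperedge_le_gap nctau _ ttau t'tau tX t'X' ntt' vt v't' ct' v2t v'v).
    by apply: subset_trans sMt; apply: subsetU1.
  move=> x; rewrite eP => v'x; rewrite cycC.
  rewrite cycC in cyc1; apply: block_side us' _ (_ : conn _ v' x) _ cyc1.
  - by rewrite conn_sym.
  - exact: connU1_mono.
  by apply: contraNN (ncv'Y _ (conn_refl Y v')); apply: conn_trans.
move/cycN=> cyc2; case/negP: nle_s.
apply: (hyperedge_le_gap ncsig _ ssig s'sig sY' s'Y' nss' ws w's' c2s' w2s w'w).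
  by apply: subset_trans sMs; apply: subsetU1.
move=> x w'x.
have {cyc2} cyc2 : cyc c v' v2.
  have Mv'v2 : conn (t |: X) v' v2.
    by apply: conn_trans (connU1_mono _ v'v) _; apply: connU1_edge.
  apply: cyc2; last exact: ncv'.
    by rewrite eq_sym; apply: (conn_neq Mv'v2 nMcv').
  by rewrite eP in w'v2; apply: (conn_neq w'v2 nPw'v').
have {cyc2} cyc3 : cyc c w2 v2.
  by apply: block_side us' cv2 _ _ cyc2; [exact: connU1_mono|apply: ncv'Y; apply: conn_refl].
have Xt'c : conn (t' |: X) v' c by apply: connU1_edge.
have Xt'w2 : conn (t' |: X) v' w2 by apply: connU1_mono; rewrite eP.
have {cyc3} cyc4 : cyc w2 x c.
  rewrite cycC in cyc3; apply: block_side ut' _ _ _ cyc3.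
  - by apply: conn_trans Xt'c; rewrite conn_sym.
  - by apply: connU1_mono; apply: conn_trans (_ : conn X w' x); rewrite ?eP // conn_sym -eP.
  apply: contraNN nt'w' => w2v2; apply: conn_trans Xt'w2 _.
  by apply: conn_trans w2v2 _; apply: connU1_mono; rewrite conn_sym.
have Mv'x : conn (t |: X) v' x.
  by rewrite eM; apply: conn_trans v'w' (connU1_mono _ w'x).
have Mv'w2 : conn (t |: X) v' w2 by apply: connU1_mono; rewrite eP.
rewrite cycC in cyc4; rewrite -cycC; apply: (block_side ut _ _ _ cyc4).
- by apply: conn_trans Mv'w2; rewrite conn_sym.
- exact: connU1_mono.
by apply: contraNN nMcv' => xc; apply: conn_trans Mv'x xc.
Qed.

(** By [swap_touch], [t'] and [s'] meet the same blocks, so that transposing the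
    last two hyperedges in both orderings keeps the partitions equal. *)
Lemma swap_components tau sigma X Y t t' s s' : nchf tau -> nchf sigma ->
  t' |: (t |: X) \subset tau -> s' |: (s |: Y) \subset sigma ->
  t \notin X -> s \notin Y -> t' \notin t |: X -> s' \notin s |: Y ->
  components X = components Y ->
  components (t |: X) = components (s |: Y) ->
  components (t' |: (t |: X)) = components (s' |: (s |: Y)) ->
  ~~ hyperedge_le tau t' t -> ~~ hyperedge_le sigma s' s ->
  components (t' |: X) = components (s' |: Y).
Proof.
move=> nctau ncsig sX sY tX sY' t'X s'Y /eq_components eP /eq_components eM.
move=> /eq_components eQ nle_t nle_s; apply/eq_components => x y.
apply/idP/idP; apply: connU1_le.
- by move=> a b; rewrite eP.
- by apply: (swap_touch nctau ncsig sX sY) nle_s.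
- by move=> a b; rewrite eP.
by apply: (swap_touch ncsig nctau sY sX) nle_t => // a b; rewrite ?eP ?eM ?eQ.
Qed.

End Swap.

(** * Sorting an ordering by adjacent transpositions *)

(** Bubble sort: to bring [u] into the order [z], it suffices to transpose
    adjacent entries that are inverted, and no pair is transposed twice. *)
Lemma bubble_sort (T : eqType) (G : pred (seq T)) (ok : rel T) (u z : seq T) :
  uniq u -> perm_eq z u ->
  (forall y a b x, perm_eq (y ++ a :: b :: x) u -> ok a b ->
     G (y ++ a :: b :: x) -> G (y ++ b :: a :: x)) ->
  (forall a b, subseq [:: a; b] u -> subseq [:: b; a] z -> ok a b) ->
  G u -> G z.
Proof.
elim: z u G => [|a z IH] u G uu pzu swap inv Gu.
  by move: pzu; rewrite perm_sym => /perm_nilP <-.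
have au : a \in u by rewrite -(perm_mem pzu) mem_head.
case/splitPr: au => [y x] in uu pzu swap inv Gu *.
have pzyx : perm_eq z (y ++ x).
  by move: pzu; rewrite perm_sym -cat1s perm_catCA /= perm_cons perm_sym.
have okya b : b \in y -> ok b a.
  move=> biny; apply: inv.
    by apply: (@cat_subseq _ [:: b] [:: a]); rewrite sub1seq // mem_head.
  apply: (@cat_subseq _ [:: a] [:: b] [:: a]); rewrite ?sub1seq ?mem_head //.
  by rewrite (perm_mem pzyx) mem_cat biny.
have front y1 x1 : perm_eq (y1 ++ a :: x1) (y ++ a :: x) ->
    {subset y1 <= y} -> G (y1 ++ a :: x1) -> G (a :: y1 ++ x1).
  elim/last_ind: y1 x1 => [//|y1 b IHy] x1.
  rewrite !cat_rcons => py sy Gy.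
  apply: (IHy (b :: x1)) => [|c cy|].
  - by apply: perm_trans py; rewrite perm_cat2l; apply/permPl/(perm_catCA [:: _] [:: _]).
  - by apply: sy; rewrite mem_rcons inE cy orbT.
  by apply: swap => //; apply/okya/sy; rewrite mem_rcons mem_head.
have syx : subseq (y ++ x) (y ++ a :: x).
  by apply: cat_subseq => //; apply: subseq_cons.
apply: (IH (y ++ x) (fun l => G (a :: l))) => //.
- exact: subseq_uniq uu.
- move=> y1 b c x1 pyx; apply: (swap (a :: y1)).
  apply: (@perm_trans _ (a :: y ++ x)); first by rewrite /= perm_cons.
  by apply/permPl/(perm_catCA [:: a]).
- move=> b c bc cb; apply: inv; first exact: subseq_trans syx.
  exact: subseq_trans cb (subseq_cons _ _).
exact: front.
Qed.

Section Matched.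
Local Opaque components.
Variable n : nat.
Implicit Types (e f : {set 'I_n.+1}) (w : seq {set 'I_n.+1})
  (l u z x y : seq ({set 'I_n.+1} * {set 'I_n.+1})).

(** A list of pairs stands for two orderings of equal length that define the same
    chain of partitions. The latest hyperedge comes first in the list, so that the
    partitions of the chain are those of the suffixes. *)
Fixpoint matched l : bool :=
  if l is _ :: l' then
    (components [set:: unzip1 l] == components [set:: unzip2 l]) && matched l'
  else true.

Lemma set_seq_cons e w : [set:: e :: w] = e |: [set:: w].
Proof. by apply/setP=> f; rewrite !inE. Qed.

Lemma eq_set_perm w w' : perm_eq w w' -> [set:: w] = [set:: w'].
Proof. by move=> pw; apply/setP=> e; rewrite !inE (perm_mem pw). Qed.

Lemma matched_components l : matched l ->
  components [set:: unzip1 l] = components [set:: unzip2 l].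
Proof. by case: l => [_|p l /andP[/eqP eM _]]; [|exact: eM]. Qed.

Lemma matched_swap tau sigma p q x y : nchf tau -> nchf sigma ->
  let u := y ++ p :: q :: x in
  uniq (unzip1 u) -> uniq (unzip2 u) ->
  {subset unzip1 u <= tau} -> {subset unzip2 u <= sigma} ->
  ~~ hyperedge_le tau p.1 q.1 -> ~~ hyperedge_le sigma p.2 q.2 ->
  matched u -> matched (y ++ q :: p :: x).
Proof.
move=> nct ncs /=; elim: y => [|r y IH] /=; last first.
  move=> /andP[_ u1] /andP[_ u2] s1 s2 le1 le2 /andP[/eqP eM m].
  have t1 : {subset unzip1 (y ++ p :: q :: x) <= tau}.
    by move=> e ey; apply: s1; rewrite inE ey orbT.
  have t2 : {subset unzip2 (y ++ p :: q :: x) <= sigma}.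
    by move=> e ey; apply: s2; rewrite inE ey orbT.
  rewrite (IH u1 u2 t1 t2 le1 le2 m).
  rewrite andbT; apply/eqP; rewrite !set_seq_cons in eM *.
  rewrite (eq_set_perm (w := unzip1 (y ++ q :: p :: x)) (w' := unzip1 (y ++ p :: q :: x))).
    rewrite eM; congr (components (_ |: _)); apply: eq_set_perm.
    by apply: perm_map; rewrite perm_cat2l; apply/permPl/(perm_catCA [:: _] [:: _]).
  by apply: perm_map; rewrite perm_cat2l; apply/permPl/(perm_catCA [:: _] [:: _]).
rewrite !inE !negb_or -!andbA => /and4P[npq1 px1 qx1 _] /and4P[npq2 px2 qx2 _].
move=> s1 s2 le1 le2 /and3P[/eqP eQ /eqP eM mx].
have blocks1 e w : components [set:: e :: w] = components (e |: [set:: w]).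
  by rewrite set_seq_cons.
have blocks2 e f w :
    components [set:: e :: f :: w] = components (e |: (f |: [set:: w])).
  by rewrite !set_seq_cons.
have {}eM := etrans (esym (blocks1 _ _)) (etrans eM (blocks1 _ _)).
have {}eQ := etrans (esym (blocks2 _ _ _)) (etrans eQ (blocks2 _ _ _)).
apply/and3P; split; last exact: mx.
  apply/eqP; apply: (etrans (blocks2 _ _ _)); apply: etrans (esym (blocks2 _ _ _)).
  by rewrite setUCA; apply: (etrans eQ); rewrite setUCA.
apply/eqP; apply: (etrans (blocks1 _ _)); apply: etrans (esym (blocks1 _ _)).
have eP := matched_components mx.
apply: (swap_components nct ncs _ _ _ _ _ _ eP eM eQ le1 le2).
- by apply/subsetP=> e; rewrite -!set_seq_cons inE; apply: s1.
- by apply/subsetP=> e; rewrite -!set_seq_cons inE; apply: s2.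
- by rewrite inE.
- by rewrite inE.
- by rewrite !inE negb_or npq1.
by rewrite !inE negb_or npq2.
Qed.

(** Sorting acts on both orderings at once. Only pairs that the two posets allow
    to be transposed may be inverted. *)
Lemma matched_sort tau sigma u z : nchf tau -> nchf sigma ->
  uniq (unzip1 u) -> uniq (unzip2 u) ->
  {subset unzip1 u <= tau} -> {subset unzip2 u <= sigma} -> perm_eq z u ->
  (forall p q, subseq [:: p; q] u -> subseq [:: q; p] z ->
     ~~ hyperedge_le tau p.1 q.1 /\ ~~ hyperedge_le sigma p.2 q.2) ->
  matched u -> matched z.
Proof.
move=> nct ncs u1 u2 s1 s2 pzu inv.
apply: (bubble_sort (ok := fun p q =>
  ~~ hyperedge_le tau p.1 q.1 && ~~ hyperedge_le sigma p.2 q.2)) => //.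
- exact: map_uniq u1.
- move=> y p q x pu /andP[le1 le2].
  have [p1 p2] := (perm_map fst pu, perm_map snd pu).
  apply: (matched_swap nct ncs) => //.
  + by rewrite (perm_uniq p1).
  + by rewrite (perm_uniq p2).
  + by move=> e; rewrite (perm_mem p1); apply: s1.
  + by move=> e; rewrite (perm_mem p2); apply: s2.
by move=> p q pq qp; apply/andP; apply: inv.
Qed.

End Matched.

(** * Merging blocks in the order of the poset *)

Section Intervals.
Variable n : nat.
Implicit Types (X Y : {set {set 'I_n.+1}}) (e f p : {set 'I_n.+1})
  (w : seq {set 'I_n.+1}) (x y z a b c u v : 'I_n.+1) (d : bool).

Definition local_le e f : bool := [forall v in e :&: f, local_lt v e f].

(** Proper ([d = true]) and antiproper ([d = false]) positions of a hyperedge [e]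
    added after [f]. *)
Definition after d e f : bool := if d then local_le f e else local_le e f.

Definition dcyc d (x y z : nat) : bool := if d then cyc x y z else cyc x z y.

(** Each block merged by a hyperedge in proper position is a cyclic interval of
    the new block, and the hyperedge meets it in its first vertex; in antiproper
    position it meets it in the last vertex. Indeed the earlier hyperedges at [v]
    all lie on the same side of [e], and what hangs on them cannot cross the
    chord from [v] to [v']. *)
Lemma merge_interval d tau X e v v' x : nchf tau -> X \subset tau ->
  e \in tau -> e \notin X -> (forall f, f \in X -> after d e f) ->
  v \in e -> v' \in e -> v != v' -> conn X v x -> x != v -> dcyc d v x v'.
Proof.
move=> nct sX etau eX aft ve v'e nvv' vx nxv.
have [p [u [pX vp up nuv ux]]] : exists p u,
    [/\ p \in X, v \in p, u \in p, u != v & conn (X :\ p) u x].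
  by apply: conn_first; rewrite // eq_sym.
have ptau : p \in tau := subsetP sX p pX.
have nep : e != p by apply: contraNneq eX => ->.
have un : uncrossed (e |: X :\ p).
  apply/nchf_uncrossed/(nchf_sub _ nct)/subsetP => f /setU1P[->//|/setD1P[_]].
  exact: (subsetP sX).
have vv' : conn (e |: X :\ p) v v' by apply: connU1_edge.
have ux' : conn (e |: X :\ p) u x by apply: connU1_mono.
have nvu : ~~ conn (e |: X :\ p) v u.
  apply: contraNN nuv => vu; apply/eqP; apply: (nchf_bridged nct ptau) => //.
  rewrite conn_sym; apply: conn_mono vu; apply/subsetP=> f.
  rewrite !inE => /orP[/eqP->|/andP[-> fX]]; first by rewrite nep.
  by rewrite (subsetP sX).
have vep : v \in e :&: p by rewrite inE ve vp.
case: d aft => /(_ p pX) /forall_inP aft /=.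
  have /local_ltP[_ _ _ lt] : local_lt v p e by apply: aft; rewrite setIC.
  by apply: block_side un vv' ux' nvu (lt u v' up nuv v'e _); rewrite eq_sym.
have /local_ltP[_ _ _ lt] := aft v vep.
have := lt v' u v'e _ up nuv; rewrite eq_sym nvv' => /(_ isT).
rewrite cycC [cyc v v' x]cycC; apply: block_side un _ ux' _.
  by rewrite conn_sym.
by apply: contraNN nvu; apply: conn_trans.
Qed.

Lemma dcyc_merge_contra d (a b c e : nat) :
  dcyc d a b c -> dcyc d b a e -> c = e \/ dcyc d c e a -> False.
Proof.
case: d => /= h1 h2 [ece|h3]; first by subst; move: h1 h2; rewrite /cyc; lia.
- by move: h1 h2 h3; rewrite /cyc; lia.
- by subst; move: h1 h2; rewrite /cyc; lia.
by move: h1 h2 h3; rewrite /cyc; lia.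
Qed.

Lemma merge_unique_sub d tau sigma X Y e f : nchf tau -> nchf sigma ->
  e |: X \subset tau -> f |: Y \subset sigma -> e \notin X -> f \notin Y ->
  (forall p, p \in X -> after d e p) -> (forall p, p \in Y -> after d f p) ->
  conn X =2 conn Y -> conn (e |: X) =2 conn (f |: Y) -> e \subset f.
Proof.
move=> nct ncs; rewrite !subUset !sub1set => /andP[et sX] /andP[fs sY] eX fY.
move=> ae af eP eM; apply/subsetP=> v ve.
have [v2 v2e nv2v] := exists_other v (nchf_hypergraph nct) et.
have nv : ~~ conn X v v2.
  apply: contraNN nv2v => vv2; apply/eqP/esym.
  exact: (bridged_touch (nchf_bridged nct) sX et eX).
have vv2 : conn (f |: Y) v v2 by rewrite -eM connU1_edge.
have nvY : ~~ conn Y v v2 by rewrite -eP.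
have [v' v'f vv'] := conn_touch vv2 nvY.
have [v2' v2'f v2v2'] : exists2 a, a \in f & conn Y v2 a.
  by apply: (@conn_touch _ Y f v2 v); rewrite conn_sym.
have [->//|nv'v] := eqVneq v v'; exfalso.
have nv'v2' : v' != v2'.
  apply: contraNneq nv => ev; rewrite eP; apply: conn_trans vv' _.
  by rewrite ev conn_sym.
have c1 : dcyc d v v' v2.
  by apply: (merge_interval nct sX et eX ae); rewrite ?eP // eq_sym.
have c2 : dcyc d v' v v2'.
  by apply: (merge_interval ncs sY fs fY af); rewrite // conn_sym.
apply: (dcyc_merge_contra c1 c2).
have [->|nv2] := eqVneq v2 v2'; [by left|right].
by apply: (merge_interval nct sX et eX ae); rewrite ?eP // eq_sym.
Qed.

(** The blocks that are merged and their cyclic positions are read off from the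
    two partitions, and the hyperedge consists of the first vertices of these
    intervals, or of the last ones. *)
Lemma merge_unique d tau sigma X Y e f : nchf tau -> nchf sigma ->
  e |: X \subset tau -> f |: Y \subset sigma -> e \notin X -> f \notin Y ->
  (forall p, p \in X -> after d e p) -> (forall p, p \in Y -> after d f p) ->
  components X = components Y -> components (e |: X) = components (f |: Y) ->
  e = f.
Proof.
move=> nct ncs sX sY eX fY ae af /eq_components eP /eq_components eM.
apply/eqP; rewrite eqEsubset (merge_unique_sub (d := d) nct ncs sX sY) //.
by rewrite (merge_unique_sub (d := d) ncs nct sY sX) // => a b; rewrite ?eP ?eM.
Qed.

(** The vertex that follows [v] clockwise in its block; [v] itself comes last. *)
Definition next_vertex X v : 'I_n.+1 :=
  [arg min_(u < v | conn X v u) ((u + n - v) %% n.+1)].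

Lemma next_vertexP X v : conn X v (next_vertex X v) /\ (forall x, conn X v x -> x != v ->
  next_vertex X v != v /\ (next_vertex X v = x \/ cyc v (next_vertex X v) x)).
Proof.
have keyE u : (u + n - v) %% n.+1 = if v < u then u - v.+1 else u + n - v.
  have := ltn_ord u; have := ltn_ord v; case: (ltnP v u) => [lt_vu|le_uv] ltv ltu.
    have -> : u + n - v = u - v.+1 + n.+1 by lia.
    by rewrite modnDr modn_small //; lia.
  by rewrite modn_small //; lia.
rewrite /next_vertex; case: arg_minnP => [|z vz minz]; first exact: conn_refl.
split=> // x vx; have := minz x vx; rewrite !keyE -!val_eqE /= => le_zx nxv.
have ltx := ltn_ord x; have ltz := ltn_ord z; have ltv := ltn_ord v.
split; first by move: le_zx; case: (ltnP v z); case: (ltnP v x); lia.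
have [ezx|nzx] := eqVneq (z : nat) x; [by left; apply: ord_inj|right].
by move: le_zx; rewrite /cyc; case: (ltngtP v z); case: (ltngtP v x); lia.
Qed.

Lemma next_unique X v z : conn X v z ->
  (forall x, conn X v x -> x != v -> z != v /\ (z = x \/ cyc v z x)) ->
  next_vertex X v = z.
Proof.
have [vN minN] := next_vertexP X v; move=> vz minz.
have [ez|nz] := eqVneq z v.
  have [//|nN] := eqVneq (next_vertex X v) v; first by move=> ->.
  by have [] := minz _ vN nN; rewrite ez eqxx.
have [nN [//|c1]] := minN z vz nz.
have [_ [->//|c2]] := minz _ vN nN.
by case/negP: (cyc_asym c1).
Qed.

End Intervals.

Section LastMerge.
Variables (n : nat) (tau X : {set {set 'I_n.+1}}) (e : {set 'I_n.+1}).
Hypotheses (nct : nchf tau) (sX : X \subset tau) (etau : e \in tau)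
  (eX : e \notin X) (aft : forall f, f \in X -> after false e f).
Implicit Types (x y z a b c u v : 'I_n.+1).

Let last v v' x : v \in e -> v' \in e -> v != v' -> conn X v x -> x != v ->
  cyc v v' x.
Proof. exact: (merge_interval nct sX etau eX aft). Qed.

Let inj x y : x \in e -> y \in e -> conn X x y -> x = y.
Proof. exact: (bridged_touch (nchf_bridged nct) sX). Qed.

(** The vertex of a block that follows its last vertex is its first one. *)
Lemma next_first v v' x y : v \in e -> v' \in e -> v != v' ->
  conn X v x -> x != next_vertex X v -> conn X v' y -> cyc (next_vertex X v) x y.
Proof.
move=> ve v'e nvv' vx nxz v'y; have [vz minz] := next_vertexP X v.
have nyz z : cyc v v' z -> cyc v y z.
  have [->//|nyv'] := eqVneq y v'.
  have nv'v : v' != v by rewrite eq_sym.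
  have := last v'e ve nv'v v'y nyv'; rewrite cycC => h1; exact: cyc_trans.
have [exv|nxv] := eqVneq x v.
  rewrite {x vx}exv in nxz *; rewrite cycC; apply: nyz; apply: last => //.
  by rewrite eq_sym.
have [nzv [ezx|czx]] := minz x vx nxv; first by rewrite ezx eqxx in nxz.
by rewrite -cycC; apply: cyc_shift (nyz _ (last ve v'e nvv' vz nzv)) czx.
Qed.

Definition shift_edge : {set 'I_n.+1} := [set next_vertex X v | v in e].

(** Merging blocks at their last vertices changes the successors of these
    vertices only; the new successors are first vertices of the blocks. *)
Lemma next_merge_in v : v \in e -> next_vertex (e |: X) v \in shift_edge.
Proof.
move=> ve; have [v' v'e nv'v] := exists_other v (nchf_hypergraph nct) etau.
set u := next_vertex _ v; have [vu minu] := next_vertexP (e |: X) v.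
have [b be bu] : exists2 b, b \in e & conn X b u.
  by case/connU1: vu => [|[a [b []]]]; [exists v|exists b].
have [nuv uv'] := minu v' (connU1_edge X ve v'e) nv'v.
have [ebv|nbv] := eqVneq b v.
  rewrite {b}ebv in be bu; rewrite eq_sym in nv'v.
  have c1 := last ve v'e nv'v bu nuv.
  case: uv' => [euv'|c2]; last by case/negP: (cyc_asym c1).
  by have [_ + _] := cyc_neq c1; rewrite -euv' eqxx.
have [->|nuz] := eqVneq u (next_vertex X b); first by apply: imset_f.
have c1 := next_first be ve nbv bu nuz (conn_refl X v).
have [bz _] := next_vertexP X b.
have vz : conn (e |: X) v (next_vertex X b).
  by apply: conn_trans (connU1_mono _ bz); apply: connU1_edge.
have [nzv _ _] := cyc_neq c1; have [_ _ nzv'] := cyc_neq c1.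
have [_ [euz|c2]] := minu _ vz nzv'; first by rewrite -euz eqxx in nuz.
by case/negP: (cyc_asym c1); rewrite cycC.
Qed.

Lemma next_merge_notin v : v \notin e -> next_vertex (e |: X) v = next_vertex X v.
Proof.
move=> nve; have [vz minz] := next_vertexP X v.
apply: next_unique; first exact: connU1_mono.
move=> x Qvx nxv; have [vx|nvx] := boolP (conn X v x); first exact: minz.
case/connU1: Qvx => [vx|[a [b [ae be va bx]]]]; first by rewrite vx in nvx.
have nav : a != v by apply: contraNneq nve => <-.
have nab : a != b by apply: contraNneq nvx => eab; rewrite eab in va; apply: conn_trans bx.
have [nzv za] := minz a va nav; split=> //; right.
have cax : cyc v a x.
  have c1 : cyc a b v by apply: last; rewrite // 1?conn_sym // eq_sym.
  have [->|nxb] := eqVneq x b; first by rewrite cycC.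
  have c2 : cyc b a x by apply: last; rewrite // eq_sym.
  by rewrite cycC; apply: cyc_trans c1; rewrite -cycC.
by case: za => [->//|c1]; apply: cyc_trans cax.
Qed.

End LastMerge.

Section Antipode.
Variable n : nat.
Implicit Types (X Y S : {set {set 'I_n.+1}}) (e f : {set 'I_n.+1})
  (w : seq {set 'I_n.+1}) (x y z a b c d u v : 'I_n.+1).

Definition ordered (proper : bool) w : bool := pairwise (after proper) w.

(** Each hyperedge of an antiproper ordering consists of the last vertices of the
    blocks that it merges. Replacing these by the first vertices yields a proper
    ordering of another hypertree with the same chain of partitions: the simplex
    of that hypertree is opposite to the one of [w] in the sphere of [w]. *)
Fixpoint antipode w : seq {set 'I_n.+1} :=
  if w is e :: w' then shift_edge [set:: w'] e :: antipode w' else [::].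

Lemma size_antipode w : size (antipode w) = size w.
Proof. by elim: w => //= e w ->. Qed.

Lemma bridgedU1 X e : bridged X ->
  (forall x y, x \in e -> y \in e -> conn X x y -> x = y) -> bridged (e |: X).
Proof.
move=> bX ie f x y; have [eX|neX] := boolP (e \in X).
  by rewrite (setUidPr _) ?sub1set //; apply: bX.
case/setU1P=> [->|fX] xf yf; first by rewrite setU1K //; apply: ie.
have nef : e != f by apply: contraNneq neX => ->.
have -> : (e |: X) :\ f = e |: X :\ f.
  apply/setP=> g; rewrite !inE andb_orr; congr (_ || _).
  by apply: andb_idl => /eqP ->.
case/connU1=> [|[a [b [ae be xa bY]]]]; first exact: bX fX xf yf.
have sXf : X :\ f \subset X by apply: subD1set.
have eab : a = b.
  apply: ie => //; have ax : conn X a x by rewrite conn_sym (conn_mono sXf).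
  apply: conn_trans ax (conn_trans (conn_edge fX xf yf) _).
  by rewrite conn_sym (conn_mono sXf).
by apply: (bX f) => //; apply: conn_trans xa _; rewrite eab.
Qed.

Lemma chords_crossCr (a c b d : nat) : chords_cross a c b d = chords_cross a c d b.
Proof.
rewrite /chords_cross; rewrite [cyc a b c == _]eq_sym.
by case: (a != c) (b != a) (b != c) (d != a) (d != c) => [] [] [] [] [].
Qed.

Lemma first_uncrossed (z a c b d : nat) : a = z \/ cyc z a b /\ cyc z a d ->
  c = z \/ cyc z c b /\ cyc z c d -> ~~ chords_cross a c b d.
Proof.
have same (x : nat) : x = z \/ cyc z x b /\ cyc z x d -> cyc b x d = cyc b z d.
  by case=> [->//|[c1 c2]]; apply/idP/idP => c3; cyc_lia.
by rewrite chords_crossC /chords_cross => /same -> /same ->; rewrite eqxx !andbF.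
Qed.

(* One step of the construction: [S] and [T] are the hyperedges before and after
   replacement, and [e] is added in antiproper position to [S]. *)
Section Step.
Variables (sigma S T : {set {set 'I_n.+1}}) (e : {set 'I_n.+1}).
Hypotheses (ncs : nchf sigma) (sS : S \subset sigma) (es : e \in sigma)
  (eS : e \notin S) (aft : forall f, f \in S -> after false e f).
Hypotheses (nct : nchf T) (eP : conn T =2 conn S).
Let e' := shift_edge S e.

Let inj x y : x \in e -> y \in e -> conn S x y -> x = y.
Proof. exact: (bridged_touch (nchf_bridged ncs) sS). Qed.

Lemma shift_conn : conn (e' |: T) =2 conn (e |: S).
Proof.
move=> x y; apply/idP/idP; apply: connU1_le => [a b|]; rewrite ?eP //.
  move=> _ /imsetP[v ve ->]; exists v => //; rewrite conn_sym.
  by case: (next_vertexP S v).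
move=> v ve; exists (next_vertex S v); first exact: imset_f.
by rewrite eP; case: (next_vertexP S v).
Qed.

Lemma shift_inj x y : x \in e' -> y \in e' -> conn T x y -> x = y.
Proof.
case/imsetP=> v ve -> /imsetP[v' v'e ->]; rewrite eP => vv'; congr next_vertex.
apply: inj => //; have [[vz _] [vz' _]] := (next_vertexP S v, next_vertexP S v').
by apply: conn_trans vz (conn_trans vv' _); rewrite conn_sym.
Qed.

Lemma card_shift : #|e'| = #|e|.
Proof.
apply: card_in_imset => v v' ve v'e evv'; apply: inj => //.
have [[vz _] [vz' _]] := (next_vertexP S v, next_vertexP S v').
by apply: conn_trans vz _; rewrite evv' conn_sym.
Qed.

Lemma shift_notin : e' \notin T.
Proof.
apply/negP=> eT; have e2 := nchf_hypergraph nct eT.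
have /card_gt0P[x xe'] : 0 < #|e'| by apply: leq_trans e2.
have [y ye' nyx] := exists_other x (nchf_hypergraph nct) eT.
by case/eqP: nyx; apply: shift_inj => //; apply: conn_edge eT ye' xe'.
Qed.

(** The hyperedge [f] lies in a block of [S]. If [e] merges this block, it is an
    interval that [e'] meets in its first vertex; otherwise it does not cross the
    block into which [e] merges the others. *)
Lemma shift_uncrossed f a c b d : f \in T ->
  a \in f -> c \in f -> b \in e' -> d \in e' -> ~~ chords_cross a c b d.
Proof.
move=> fT af cf be' de'; have ac : conn S a c by rewrite -eP; apply: conn_edge fT af cf.
have [->|nbd] := eqVneq b d; first exact: chords_crossxx.
case/imsetP: be' nbd => v ve -> {b}; case/imsetP: de' => v' v'e -> {d} nbd.
have nvv' : v != v' by apply: contraNneq nbd => ->.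
have [[vz _] [vz' _]] := (next_vertexP S v, next_vertexP S v').
have first := next_first ncs sS es eS aft.
have [/existsP[u /andP[ue ua]]|none] := boolP [exists u in e, conn S u a].
  have uc := conn_trans ua ac.
  have pos x v1 : v1 \in e -> conn S u x -> u != v1 ->
      x = next_vertex S u \/ cyc (next_vertex S u) x (next_vertex S v1).
    move=> v1e ux nuv1; have [->|nx] := eqVneq x (next_vertex S u); [by left|right].
    by apply: first nuv1 ux nx _ => //; case: (next_vertexP S v1).
  have block1 v1 v2 : v1 \in e -> v2 \in e -> v1 != v2 -> u = v1 ->
      ~~ chords_cross a c (next_vertex S v1) (next_vertex S v2).
    move=> v1e v2e nv12 eu; rewrite -{}eu {v1 v1e} in nv12 *.
    rewrite /chords_cross; case: (pos a v2 v2e ua nv12) => [->|c1].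
      by rewrite eqxx /= andbF.
    case: (pos c v2 v2e uc nv12) => [->|c2]; first by rewrite eqxx /= !andbF.
    by rewrite -/(chords_cross _ _ _ _) chords_crossC /chords_cross c1 c2 !andbF.
  have [euv|nuv] := eqVneq u v; first exact: block1.
  have [euv'|nuv'] := eqVneq u v'.
    by rewrite chords_crossCr; apply: block1; rewrite // eq_sym.
  apply: (@first_uncrossed (next_vertex S u)).
    case: (pos a v ve ua nuv) => [->|c1]; first by left.
    by case: (pos a v' v'e ua nuv') => [->|c2]; [left|right].
  case: (pos c v ve uc nuv) => [->|c1]; first by left.
  by case: (pos c v' v'e uc nuv') => [->|c2]; [left|right].
have ueS : uncrossed (e |: S).
  by apply/nchf_uncrossed/(nchf_sub _ ncs); rewrite subUset sub1set es.
apply: (blocks_uncrossed ueS).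
- exact: connU1_mono.
- apply: (@conn_trans _ _ v); first by rewrite conn_sym; apply: connU1_mono.
  by apply: (@conn_trans _ _ v'); [apply: connU1_edge|apply: connU1_mono].
apply: contraNN none => /connU1[aN|[u [_ [ue _ au _]]]]; apply/existsP.
  by exists v; rewrite ve (conn_trans vz) // conn_sym.
by exists u; rewrite ue conn_sym.
Qed.

Lemma shift_local_lt f x : f \in T -> x \in f -> x \in e' -> local_lt x f e'.
Proof.
move=> fT xf xe'; apply/local_ltP; split=> //.
  by apply: contraNneq shift_notin => <-.
case/imsetP: xe' => v ve -> in xf * => y z yf ny /imsetP[v' v'e ->] nz.
have [[vz _] [vz' _]] := (next_vertexP S v, next_vertexP S v').
apply: (next_first ncs sS es eS aft) ny vz' => //.
  by apply: contraNneq nz => ->.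
by apply: conn_trans vz _; rewrite -eP; apply: conn_edge fT xf yf.
Qed.

Lemma shift_nchf : nchf (e' |: T).
Proof.
have [hT bT uT] := nct; split.
- move=> f /setU1P[->|/hT//]; rewrite card_shift.
  exact: nchf_hypergraph ncs _ es.
- by apply: bridgedU1 => //; apply: shift_inj.
move=> f g a c b d /setU1P[->|fT] /setU1P[->|gT]; first by rewrite eqxx.
- by move=> _ ae ce bg dg; rewrite chords_crossC; apply: shift_uncrossed gT bg dg ae ce.
- by move=> _ af cf be de; apply: shift_uncrossed fT af cf be de.
exact: uT.
Qed.

End Step.

Lemma antipodeP sigma w : nchf sigma -> {subset w <= sigma} -> uniq w ->
  ordered false w ->
  [/\ nchf [set:: antipode w], uniq (antipode w), ordered true (antipode w) &
      conn [set:: antipode w] =2 conn [set:: w]].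
Proof.
move=> ncs; elim: w => [|e w IH] sw /=.
  move=> _ _; split=> //; apply: (nchf_sub _ ncs); apply/subsetP=> f.
  by rewrite !inE.
case/andP=> ew uw /andP[/allP aft ow].
have es : e \in sigma by apply: sw; apply: mem_head.
have sw' : {subset w <= sigma} by move=> f fw; apply: sw; rewrite inE fw orbT.
have [nct ut ot eP] := IH sw' uw ow.
have sS : [set:: w] \subset sigma by apply/subsetP=> f; rewrite inE; apply: sw'.
have eS : e \notin [set:: w] by rewrite inE.
have aft' f : f \in [set:: w] -> after false e f by rewrite inE; apply: aft.
have nin := shift_notin ncs sS es eS nct eP.
rewrite !set_seq_cons; split.
- exact: (shift_nchf ncs sS es eS aft' nct eP).
- by rewrite ut andbT; move: nin; rewrite inE.
- rewrite /ordered /= -/(ordered true _) ot andbT; apply/allP=> f ft.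
  apply/forall_inP=> x /setIP[xf xe].
  by apply: (shift_local_lt ncs sS es eS aft' nct eP) => //; rewrite inE.
exact: (shift_conn e eP).
Qed.

End Antipode.

Section Reversal.
Variable n : nat.
Implicit Types (X Y S : {set {set 'I_n.+1}}) (e f g : {set 'I_n.+1})
  (w : seq {set 'I_n.+1}) (v : 'I_n.+1).

Lemma hyperedge_le_mono X Y e f : X \subset Y ->
  hyperedge_le X e f -> hyperedge_le Y e f.
Proof.
move=> /subsetP sXY; apply: connect_sub => {}e {}f /and3P[eX fX lt].
by apply: connect1; rewrite !sXY.
Qed.

Lemma local_lt_le X e f v : e \in X -> f \in X -> local_lt v e f ->
  hyperedge_le X e f.
Proof. by move=> eX fX lt; apply: connect1; rewrite eX fX; apply/existsP; exists v. Qed.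

Lemma mem_zip_snd (S T : eqType) (s : seq S) (t : seq T) p :
  p \in zip s t -> p.2 \in t.
Proof.
elim: s t => [|x s IH] [|y t] //=; rewrite !inE => /orP[/eqP->|/IH->].
  by rewrite eqxx.
by rewrite orbT.
Qed.

Lemma uniq_map_inj (S T : eqType) (f : S -> T) (s : seq S) :
  uniq (map f s) -> {in s &, injective f}.
Proof.
elim: s => [//|a s IH] /= /andP[fa us] x y; rewrite !inE.
case/orP=> [/eqP->|xs] /orP[/eqP->|ys] // efxy; last exact: IH.
  by rewrite efxy map_f in fa.
by rewrite -efxy map_f in fa.
Qed.

Variable sigma : {set {set 'I_n.+1}}.
Hypothesis ncs : nchf sigma.

(** Following the vertex after [v] in its block along the construction, one
    meets the images of all the hyperedges at [v], one locally above the other. *)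
Lemma antipode_trace w : {subset w <= sigma} -> uniq w -> ordered false w ->
  forall p v, p \in zip (antipode w) w -> v \in p.2 ->
  exists g, [/\ g \in antipode w, next_vertex [set:: w] v \in g &
                hyperedge_le [set:: antipode w] p.1 g].
Proof.
elim: w => [//|e w IH] sw /=.
case/andP=> ew uw /andP[/allP aft ow] p v.
have es : e \in sigma by apply: sw; apply: mem_head.
have sw' : {subset w <= sigma} by move=> f fw; apply: sw; rewrite inE fw orbT.
have [nct ut ot eP] := antipodeP ncs sw' uw ow.
have sS : [set:: w] \subset sigma by apply/subsetP=> f; rewrite inE; apply: sw'.
have eS : e \notin [set:: w] by rewrite inE.
have aft' f : f \in [set:: w] -> after false e f by rewrite inE; apply: aft.
rewrite !set_seq_cons; set e' := shift_edge _ _.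
rewrite inE => /orP[/eqP->|pw] vp.
  exists e'; split; first exact: mem_head.
    exact: (next_merge_in ncs sS es eS aft').
  exact: connect0.
have [g [gw vg pg]] := IH sw' uw ow p v pw vp.
have {}pg : hyperedge_le (e' |: [set:: antipode w]) p.1 g.
  by apply: hyperedge_le_mono pg; apply: subsetU1.
have [ve|nve] := boolP (v \in e); last first.
  exists g; split; rewrite ?inE ?gw ?orbT //.
  by rewrite (next_merge_notin ncs sS es eS aft').
exists e'; split; first exact: mem_head.
  exact: (next_merge_in ncs sS es eS aft').
apply: connect_trans pg _; apply: (local_lt_le (v := next_vertex [set:: w] v)).
- by rewrite !inE gw orbT.
- exact: setU11.
apply: (shift_local_lt ncs sS es eS aft' nct eP) => //; first by rewrite inE.
exact: imset_f.
Qed.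

(** The image of a later hyperedge [p.2] at [v] contains the successor of [v], hence
    shares it with the end of the trace that starts at the image of [q.2]. *)
Lemma antipode_local_rev w : {subset w <= sigma} -> uniq w -> ordered false w ->
  forall p q v, p \in zip (antipode w) w -> q \in zip (antipode w) w ->
  local_lt v p.2 q.2 -> hyperedge_le [set:: antipode w] q.1 p.1.
Proof.
elim: w => [//|e w IH] sw /=.
case/andP=> ew uw /andP[/allP aft ow] p q v.
have es : e \in sigma by apply: sw; apply: mem_head.
have sw' : {subset w <= sigma} by move=> f fw; apply: sw; rewrite inE fw orbT.
have [nct ut ot eP] := antipodeP ncs sw' uw ow.
have sS : [set:: w] \subset sigma by apply/subsetP=> f; rewrite inE; apply: sw'.
have eS : e \notin [set:: w] by rewrite inE.
have aft' f : f \in [set:: w] -> after false e f by rewrite inE; apply: aft.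
rewrite !set_seq_cons; set e' := shift_edge _ _.
rewrite !inE => /orP[/eqP->|pw] /orP[/eqP->|qw] lt /=.
- exact: connect0.
- have [ve vq _ _] := local_ltP _ _ _ lt.
  have [g [gw vg qg]] := antipode_trace sw' uw ow qw vq.
  apply: connect_trans (hyperedge_le_mono _ qg) _; first exact: subsetU1.
  apply: (local_lt_le (v := next_vertex [set:: w] v)).
  + by rewrite !inE gw orbT.
  + exact: setU11.
  apply: (shift_local_lt ncs sS es eS aft' nct eP) => //; first by rewrite inE.
  exact: imset_f.
- have [vp ve _ _] := local_ltP _ _ _ lt; have pw2 := mem_zip_snd pw.
  have /forall_inP/(_ v) := aft _ pw2; rewrite inE ve vp => /(_ isT).
  by rewrite (negbTE (local_lt_asym (nchf_hypergraph ncs) _ _ lt)) //; apply: sw'.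
apply: hyperedge_le_mono (IH sw' uw ow _ _ _ pw qw lt).
exact: subsetU1.
Qed.

Lemma antipode_rev w : w =i sigma -> uniq w -> ordered false w ->
  forall p q, p \in zip (antipode w) w -> q \in zip (antipode w) w ->
  hyperedge_le sigma p.2 q.2 -> hyperedge_le [set:: antipode w] q.1 p.1.
Proof.
move=> ew uw ow p q pw qw /connectP[s]; elim: s p pw => [|f s IH] p pw /=.
  move=> _ eqp; have u2 : uniq (unzip2 (zip (antipode w) w)).
    by rewrite unzip2_zip // size_antipode.
  have -> : p = q by apply: (uniq_map_inj u2) pw qw _.
  exact: connect0.
case/andP=> /and3P[ps fs /existsP[v lt]] path_s last_s.
have [r rw erf] : exists2 r, r \in zip (antipode w) w & r.2 = f.
  have: f \in unzip2 (zip (antipode w) w).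
    by rewrite unzip2_zip ?size_antipode // ew.
  by case/mapP=> r rw ->; exists r.
subst f; apply: connect_trans (IH r rw path_s last_s) _.
by apply: (antipode_local_rev _ uw ow pw rw lt) => g; rewrite ew.
Qed.

Lemma antipode_matched w : {subset w <= sigma} -> uniq w -> ordered false w ->
  matched (zip (antipode w) w).
Proof.
elim: w => [//|e w IH] sw uw ow.
have [_ _ _ /eq_components eP] := antipodeP ncs sw uw ow.
rewrite /= -/(matched _) !unzip1_zip ?unzip2_zip ?size_antipode //.
apply/andP; split; first exact/eqP.
move: uw ow => /= /andP[_ uw] /andP[_ ow]; apply: IH => // f fw.
by apply: sw; rewrite inE fw orbT.
Qed.

End Reversal.

Section Orderings.
Variable n : nat.
Implicit Types (X Y : {set {set 'I_n.+1}}) (e f g : {set 'I_n.+1})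
  (w : seq {set 'I_n.+1}) (x y v a b : 'I_n.+1) (d : bool).

Lemma local_lt_total X v e f : nchf X -> e \in X -> f \in X -> e != f ->
  v \in e -> v \in f -> local_lt v e f || local_lt v f e.
Proof.
move=> ncX eX fX nef ve vf.
have [a ae nav] := exists_other v (nchf_hypergraph ncX) eX.
have [b bf nbv] := exists_other v (nchf_hypergraph ncX) fX.
have nab : a != b.
  apply: contraNneq nav => eab.
  by rewrite (bridged_inter (nchf_bridged ncX) eX fX nef ae _ ve vf) // eab.
have [c1|] := boolP (cyc v a b).
  by rewrite (local_lt_pair ncX eX fX nef ve vf ae bf c1).
move/cycN => c2; apply/orP; right.
rewrite eq_sym in nef; apply: (local_lt_pair ncX fX eX nef vf ve bf ae).
by apply: c2 => //; rewrite eq_sym.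
Qed.

(** Among the pairs of a vertex [v] and the last hyperedge [f] at [v], one that
    maximizes the set of vertices reached from [v] without [f]: the last
    hyperedge at another vertex of [f] would reach more, so it is [f]. *)
Lemma exists_last X : nchf X -> X != set0 ->
  exists2 e, e \in X & forall f, f \in X -> f != e -> local_le f e.
Proof.
move=> ncX nX0; have [hX bX uX] := ncX.
pose last v f := [&& f \in X, v \in f &
  [forall g in X, (v \in g) && (g != f) ==> local_lt v g f]].
have exlast g v : g \in X -> v \in g -> exists f, last v f.
  move=> gX vg; have [x0 x0g nx0] := exists_other v hX gX.
  pose P x := (x != v) && [exists f in X, (v \in f) && (x \in f)].
  have Px0 : P x0 by rewrite /P nx0; apply/existsP; exists g; rewrite gX vg.
  case: (arg_maxnP (fun x => clockwise_dist v x) Px0) => x /andP[nxv].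
  case/existsP=> f /andP[fX /andP[vf xf]] maxx; exists f.
  rewrite /last fX vf; apply/forall_inP=> h hX'; apply/implyP=> /andP[vh nhf].
  have [y yh nyv] := exists_other v hX hX'.
  have nyx : y != x.
    apply: contraNneq nyv => eyx.
    by rewrite (bridged_inter bX hX' fX nhf yh _ vh vf) // eyx.
  apply: (local_lt_pair ncX hX' fX nhf vh vf yh xf).
  have Py : P y by rewrite /P nyv; apply/existsP; exists h; rewrite hX' vh.
  have := maxx y Py; rewrite /= leqNgt ltn_clockwise_dist // => ncyc.
  by apply: cycN ncyc; rewrite // eq_sym.
have [g0 g0X] := set0Pn _ nX0.
have [v0 v0g] : exists v, v \in g0.
  by apply/card_gt0P; apply: leq_trans (hX _ g0X).
have [f0 lastf0] := exlast _ _ g0X v0g.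
pose D (p : 'I_n.+1 * {set 'I_n.+1}) := #|[set x | conn (X :\ p.2) p.1 x]|.
case: (@arg_maxnP _ (v0, f0) (fun p => last p.1 p.2) D lastf0) => -[v f] /= lastf maxD.
have [fX vf _] := and3P lastf; exists f => // g gX ngf.
apply/forall_inP=> v' /setIP[v'g v'f].
suff /and3P[_ _ /forall_inP/(_ g gX)] : last v' f by rewrite v'g ngf.
have [<-//|nvv'] := eqVneq v v'.
have [f2 lastf2] := exlast _ _ fX v'f; have [f2X v'f2 _] := and3P lastf2.
have [<-//|nf2] := eqVneq f2 f; exfalso.
have := maxD (v', f2) lastf2; rewrite /D /= leqNgt => /negP; apply.
have nvv'X : ~~ conn (X :\ f) v v'.
  by apply: contraNN nvv' => c; apply/eqP/(bX f).
apply: proper_card; apply/properP; split; last first.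
  by exists v'; rewrite !inE // conn_refl.
apply/subsetP=> x; rewrite !inE => vx.
have v'v : conn (X :\ f2) v' v by apply: conn_edge v'f vf; rewrite !inE fX eq_sym nf2.
apply: conn_trans v'v _.
have sub : X :\ f :\ f2 \subset X :\ f2 by rewrite setSD ?subD1set.
apply: conn_mono sub _.
have f2Xf : f2 \in X :\ f by rewrite !inE nf2.
move: (vx); rewrite -{1}(setD1K f2Xf) => /connU1[//|[a [b [af2 bf2 va _]]]].
case/negP: nvv'X; apply: (@conn_trans _ _ a); last exact: conn_edge f2Xf af2 v'f2.
by apply: conn_mono va; apply: subD1set.
Qed.

Lemma exists_ordered X : nchf X -> exists2 w, perm_eq w (enum X) & ordered true w.
Proof.
have [m] := ubnP #|X|; elim: m X => // m IH X ltXm ncX.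
have [X0|nX0] := eqVneq X set0.
  by exists [::]; rewrite // X0 enum_set0.
have [e eX laste] := exists_last ncX nX0.
have [|w pw ow] := IH (X :\ e) _ (nchf_sub (subD1set _ _) ncX).
  by rewrite (cardsD1 e) eX in ltXm.
have mw : w =i X :\ e by move=> f; rewrite (perm_mem pw) mem_enum.
exists (e :: w).
  apply: uniq_perm; rewrite /= ?enum_uniq //.
    by rewrite mw !inE eqxx (perm_uniq pw) enum_uniq.
  move=> f; rewrite inE mw mem_enum !inE.
  by case: eqVneq => [->|].
rewrite /ordered /= -/(ordered true w) ow andbT; apply/allP=> f.
by rewrite mw !inE => /andP[nfe fX]; apply: laste.
Qed.

Lemma ordered_index d w e f : ordered d w -> e \in w -> f \in w ->
  index e w < index f w -> after d e f.
Proof.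
move=> /(pairwiseP e) ow ew fw lt; have := ow _ _ _ _ lt.
by rewrite !inE !index_mem !nth_index // => /(_ ew fw).
Qed.

Lemma subseq2_index (T : eqType) (w : seq T) (e f : T) : uniq w -> subseq [:: e; f] w ->
  [/\ e \in w, f \in w & index e w < index f w].
Proof.
elim: w => // g w IH /= /andP[gw uw]; case: eqVneq => [->|neg] sw.
  have fw : f \in w by rewrite sub1seq in sw.
  by rewrite !inE /= !eqxx fw orbT; case: eqVneq => // egf; rewrite egf fw in gw.
have [ew fw lt] := IH uw sw; rewrite !inE ew fw !orbT.
by case: eqVneq => // egf; rewrite egf fw in gw.
Qed.

(** The local orders generate the poset, so an ordering that respects them
    respects the poset. *)
Lemma ordered_le d X w e f : hypergraph X -> w =i X -> ordered d w ->
  hyperedge_le X e f -> if d then index f w <= index e w else index e w <= index f w.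
Proof.
move=> hX wX ow /connectP[s]; elim: s e => [|g s IH] e /=.
  by move=> _ ->; rewrite leqnn if_same.
case/andP=> /and3P[eX gX /existsP[v lt]] path_s last_s.
have := IH g path_s last_s; have [ve vg _ _] := local_ltP _ _ _ lt.
have ngt := local_lt_asym hX eX gX lt.
case: d ow {IH} => ow; [move=> le; apply: leq_trans le _|apply: leq_trans];
  rewrite leqNgt; apply: contraNN ngt.
  move/(ordered_index ow); rewrite !wX => /(_ eX gX) /forall_inP.
  by apply; rewrite inE ve vg.
move/(ordered_index ow); rewrite !wX => /(_ gX eX) /forall_inP.
by apply; rewrite inE ve vg.
Qed.

Lemma ordered_subseq d X w e f : hypergraph X -> uniq w -> w =i X -> ordered d w ->
  subseq [:: e; f] w -> if d then ~~ hyperedge_le X e f else ~~ hyperedge_le X f e.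
Proof.
move=> hX uw wX ow /(subseq2_index uw)[_ _]; rewrite ltnNge.
by case: d ow => ow; apply: contraNN => /(ordered_le hX wX ow).
Qed.

Lemma ordered_of_le d X w : nchf X -> uniq w -> w =i X ->
  (forall e f, subseq [:: e; f] w ->
     if d then ~~ hyperedge_le X e f else ~~ hyperedge_le X f e) -> ordered d w.
Proof.
move=> ncX uw wX ow.
have {wX} sw : {subset w <= X} by move=> e; rewrite wX.
elim: w uw sw ow => //= e w IH /andP[ew uw] sw ow.
rewrite /ordered /= -/(ordered d w) IH ?andbT //; first last.
- move=> f g fg; apply: ow; exact: subseq_trans fg (subseq_cons _ _).
- by move=> f fw; apply: sw; rewrite inE fw orbT.
have eX : e \in X by apply: sw; apply: mem_head.
apply/allP=> f fw; have fX : f \in X by apply: sw; rewrite inE fw orbT.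
have nef : e != f by apply: contraNneq ew => ->.
have := ow e f; rewrite /= eqxx sub1seq fw => /(_ isT) {ow}.
case: d {IH} => nle; apply/forall_inP=> v /setIP[v1 v2].
  have /orP[lt|//] := local_lt_total ncX eX fX nef v2 v1.
  by rewrite (local_lt_le eX fX lt) in nle.
have /orP[//|lt] := local_lt_total ncX eX fX nef v1 v2.
by rewrite (local_lt_le fX eX lt) in nle.
Qed.

Lemma ordered_rev d w : ordered d (rev w) = ordered (~~ d) w.
Proof.
elim: w => //= e w IH.
by rewrite rev_cons /ordered pairwise_rcons -/(ordered d _) IH all_rev; case: d {IH}.
Qed.

Lemma proper_orderingP X w : nchf X ->
  proper_ordering X w = perm_eq w (enum X) && ordered false w.
Proof.
move=> ncX; rewrite /proper_ordering /ordering; case: (boolP (perm_eq _ _)) => //= pw.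
have wX : w =i X by move=> e; rewrite (perm_mem pw) mem_enum.
have uw : uniq w by rewrite (perm_uniq pw) enum_uniq.
apply/idP/idP => [/forall_inP ow|ow].
  apply: (ordered_of_le ncX) => // e f /(subseq2_index uw)[ew fw].
  rewrite ltnNge; apply: contraNN => le; rewrite !wX in ew fw.
  by have /forall_inP/(_ e ew)/implyP := ow f fw; apply.
apply/forall_inP=> e eX; apply/forall_inP=> f fX; apply/implyP=> le.
exact: (ordered_le (nchf_hypergraph ncX) wX ow le).
Qed.

End Orderings.

(** * The opposite hypertree exchanges the two roles *)

Section Opposite.
Local Opaque components.
Variable n : nat.
Implicit Types (X Y tau sigma : {set {set 'I_n.+1}}) (e f : {set 'I_n.+1})
  (s t w : seq {set 'I_n.+1}) (d : bool).

Lemma perm_map_lift (S T : eqType) (h : S -> T) (u : seq S) (t : seq T) :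
  perm_eq t (map h u) -> exists2 z, perm_eq z u & map h z = t.
Proof.
elim: t u => [|a t IH] u.
  rewrite perm_sym => /perm_nilP; case: u => // _.
  by exists [::].
move=> pt; have: a \in map h u by rewrite -(perm_mem pt) mem_head.
case/mapP=> b bu ab; have pu := perm_to_rem bu.
have [|z pz hz] := IH (rem b u).
  by rewrite -(perm_cons a) (perm_trans pt) // ab -map_cons perm_map.
exists (b :: z); last by rewrite /= hz ab.
by rewrite perm_sym (perm_trans pu) // perm_cons perm_sym.
Qed.

Lemma matched_cons e f s t : size s = size t -> matched (zip (e :: s) (f :: t)) =
  (components [set:: e :: s] == components [set:: f :: t]) && matched (zip s t).
Proof.
move=> est; have [le1 le2] : size s <= size t /\ size t <= size s by rewrite est.
by rewrite {1}/matched /= -/matched (unzip1_zip le1) (unzip2_zip le2).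
Qed.

Lemma matched_zipC s t : size s = size t -> matched (zip s t) = matched (zip t s).
Proof.
elim: s t => [|e s IH] [|f t] // [est].
by rewrite !matched_cons // eq_sym IH.
Qed.

Lemma matched_zip_trans s t w : size s = size t -> size t = size w ->
  matched (zip s t) -> matched (zip t w) -> matched (zip s w).
Proof.
elim: s t w => [|e s IH] [|f t] [|g w] // [est] [etw].
rewrite !matched_cons ?est //.
move=> /andP[/eqP eq1 m1] /andP[/eqP eq2 m2].
by apply/andP; split; [rewrite eq1 eq2|apply: IH m2].
Qed.

(** The first vertices, or the last ones, of the merged blocks determine the
    hyperedges. *)
Lemma ordered_unique d tau sigma s t : nchf tau -> nchf sigma ->
  {subset s <= tau} -> {subset t <= sigma} -> uniq s -> uniq t ->
  ordered d s -> ordered d t -> size s = size t -> matched (zip s t) -> s = t.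
Proof.
move=> nct ncs; elim: s t => [|e s IH] [|f t] // ss st /andP[es us] /andP[ft ut].
move=> /andP[/allP ae os] /andP[/allP af ot] [est].
rewrite matched_cons // => /andP[/eqP eQ m].
have ss' : {subset s <= tau} by move=> g gs; apply: ss; rewrite inE gs orbT.
have st' : {subset t <= sigma} by move=> g gt; apply: st; rewrite inE gt orbT.
congr (_ :: _); last by apply: IH.
have eP := matched_components m; rewrite unzip1_zip ?unzip2_zip ?est // in eP.
apply: (merge_unique (d := d) nct ncs (X := [set:: s]) (Y := [set:: t])).
- by apply/subsetP=> g; rewrite -set_seq_cons inE; apply: ss.
- by apply/subsetP=> g; rewrite -set_seq_cons inE; apply: st.
- by rewrite inE.
- by rewrite inE.
- by move=> g; rewrite inE; apply: ae.
- by move=> g; rewrite inE; apply: af.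
- exact: eP.
by rewrite -!set_seq_cons.
Qed.

(** The simplex of [tau] lies in the sphere of [sigma]. *)
Definition in_sphere tau sigma : Prop :=
  forall t, perm_eq t (enum tau) -> ordered true t ->
    exists2 s, perm_eq s (enum sigma) & matched (zip t s).

(** The simplex of [tau] lies in the simplex opposite to that of [sigma]. *)
Definition opposite sigma tau : Prop :=
  forall t, perm_eq t (enum tau) -> ordered true t ->
    exists s, [/\ perm_eq s (enum sigma), ordered false s & matched (zip t s)].

Lemma perm_enum_size X s : perm_eq s (enum X) -> size s = #|X|.
Proof. by move/perm_size; rewrite -cardE. Qed.

Lemma perm_enum_mem X s : perm_eq s (enum X) -> s =i X.
Proof. by move=> ps e; rewrite (perm_mem ps) mem_enum. Qed.

Lemma perm_enum_uniq X s : perm_eq s (enum X) -> uniq s.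
Proof. by move=> ps; rewrite (perm_uniq ps) enum_uniq. Qed.

Lemma perm_enum_sub X s : perm_eq s (enum X) -> {subset s <= X}.
Proof. by move=> ps e; rewrite (perm_enum_mem ps). Qed.

Lemma set_seq_perm X s : perm_eq s (enum X) -> [set:: s] = X.
Proof. by move=> ps; apply/setP=> e; rewrite inE (perm_enum_mem ps). Qed.

Lemma exists_antiproper X : nchf X ->
  exists2 s, perm_eq s (enum X) & ordered false s.
Proof.
move=> ncX; have [s ps os] := exists_ordered ncX.
by exists (rev s); rewrite ?ordered_rev // perm_rev.
Qed.

(** Sort a proper ordering of [tau] towards the given antiproper ordering of
    [sigma]: the pairs transposed stand as in a proper ordering of [tau], and
    contrary to an antiproper ordering of [sigma]. *)
Lemma in_sphere_antiproper tau sigma s : nchf tau -> nchf sigma ->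
  #|tau| = #|sigma| -> in_sphere tau sigma ->
  perm_eq s (enum sigma) -> ordered false s ->
  exists2 t, perm_eq t (enum tau) & matched (zip t s).
Proof.
move=> nct ncs ets R ps os.
have [t pt ot] := exists_ordered nct; have [s0 ps0 m0] := R t pt ot.
have sz : size t = size s0 by rewrite (perm_enum_size pt) (perm_enum_size ps0).
have u1 : unzip1 (zip t s0) = t by rewrite unzip1_zip // sz.
have u2 : unzip2 (zip t s0) = s0 by rewrite unzip2_zip // sz.
have [|z pz zs] := @perm_map_lift _ _ snd (zip t s0) s.
  by rewrite -/(unzip2 _) u2 (perm_trans ps) // perm_sym.
exists (unzip1 z).
  by apply: perm_trans pt; rewrite -[X in perm_eq _ X]u1 perm_map.
rewrite -zs zip_unzip.
apply: (matched_sort nct ncs _ _ _ _ pz); rewrite ?u1 ?u2 //.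
- exact: perm_enum_uniq pt.
- exact: perm_enum_uniq ps0.
- exact: perm_enum_sub pt.
- exact: perm_enum_sub ps0.
move=> p q pq qp; split.
  apply: (ordered_subseq (d := true) (nchf_hypergraph nct)
    (perm_enum_uniq pt) (perm_enum_mem pt) ot).
  by rewrite -u1; apply: (map_subseq fst pq).
apply: (ordered_subseq (d := false) (nchf_hypergraph ncs)
  (perm_enum_uniq ps) (perm_enum_mem ps) os).
by rewrite -zs; apply: (map_subseq snd qp).
Qed.

(** The construction is carried out for one antiproper ordering; sorting carries
    it over to all proper orderings of the result, as it reverses the poset. *)
Lemma exists_opposite sigma : nchf sigma -> exists tau,
  [/\ nchf tau, #|tau| = #|sigma|, conn tau =2 conn sigma & opposite sigma tau].
Proof.
move=> ncs; have [s ps os] := exists_antiproper ncs.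
have [us ms] := (perm_enum_uniq ps, perm_enum_sub ps).
have [nct ut ot ec] := antipodeP ncs ms us os.
set tau := [set:: antipode s] in nct *.
have pt : perm_eq (antipode s) (enum tau).
  by apply: uniq_perm; rewrite ?enum_uniq // => e; rewrite mem_enum inE.
have sz : size (antipode s) = size s := size_antipode s.
exists tau; split=> //.
- by rewrite -(perm_enum_size ps) -sz (perm_enum_size pt).
- by move=> x y; rewrite ec (set_seq_perm ps).
move=> t pt' ot'.
have u1 : unzip1 (zip (antipode s) s) = antipode s by rewrite unzip1_zip // sz.
have u2 : unzip2 (zip (antipode s) s) = s by rewrite unzip2_zip // sz.
have [|z pz zt] := @perm_map_lift _ _ fst (zip (antipode s) s) t.
  by rewrite -/(unzip1 _) u1 (perm_trans pt') // perm_sym.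
have ps' : perm_eq (unzip2 z) (enum sigma).
  by apply: perm_trans ps; rewrite -[X in perm_eq _ X]u2 perm_map.
have rev_le p q : p \in z -> q \in z -> hyperedge_le sigma p.2 q.2 ->
    hyperedge_le tau q.1 p.1.
  rewrite !(perm_mem pz); apply: (antipode_rev ncs) => //.
  exact: perm_enum_mem ps.
have proper_z p q : subseq [:: p; q] z -> ~~ hyperedge_le tau p.1 q.1.
  move=> pq; apply: (ordered_subseq (d := true) (nchf_hypergraph nct)
    (perm_enum_uniq pt') (perm_enum_mem pt') ot').
  by rewrite -zt; apply: (map_subseq fst pq).
have uz : uniq z by rewrite (perm_uniq pz); apply: map_uniq (_ : uniq (unzip1 _)); rewrite u1.
exists (unzip2 z); split=> //.
  apply: (ordered_of_le ncs (perm_enum_uniq ps') (perm_enum_mem ps')) => e f ef.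
  have [r rz ref] : exists2 r, subseq r z & [:: e; f] = unzip2 r.
    case/subseqP: ef => m _ ->; exists (mask m z); first exact: mask_subseq.
    by rewrite /unzip2 map_mask.
  case: r ref rz => [|p [|q []]] //= [-> ->] pq; have [pin qin _] := subseq2_index uz pq.
  by apply: contraNN (proper_z p q pq) => /rev_le; apply.
rewrite -zt zip_unzip; apply: (matched_sort nct ncs _ _ _ _ pz); rewrite ?u1 ?u2 //.
- by move=> e; rewrite inE.
- move=> p q pq qp; split.
    apply: (ordered_subseq (d := true) (nchf_hypergraph nct)
      (perm_enum_uniq pt) (perm_enum_mem pt) ot).
    by rewrite -u1; apply: (map_subseq fst pq).
  have [qin pin _] := subseq2_index uz qp.
  by apply: contraNN (proper_z q p qp) => /rev_le; apply.
exact: (antipode_matched ncs ms us os).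
Qed.

(** [sigma] is recovered from the last vertices of the blocks merged along the
    chain of a proper ordering of [tau]. *)
Lemma opposite_inj sigma sigma' tau : nchf sigma -> nchf sigma' -> nchf tau ->
  #|tau| = #|sigma| -> #|tau| = #|sigma'| ->
  opposite sigma tau -> opposite sigma' tau -> sigma = sigma'.
Proof.
move=> ncs ncs' nct e1 e2 op op'.
have [t pt ot] := exists_ordered nct.
have [s [ps os m]] := op t pt ot; have [s' [ps' os' m']] := op' t pt ot.
have sz : size s = size t by rewrite (perm_enum_size ps) (perm_enum_size pt).
have sz' : size t = size s' by rewrite (perm_enum_size ps') (perm_enum_size pt).
suff ess' : s = s' by rewrite -(set_seq_perm ps) ess' (set_seq_perm ps').
apply: (ordered_unique ncs ncs' (perm_enum_sub ps) (perm_enum_sub ps')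
  (perm_enum_uniq ps) (perm_enum_uniq ps') os os'); first by rewrite sz.
have m1 : matched (zip s t) by rewrite matched_zipC.
exact: (matched_zip_trans sz sz' m1 m').
Qed.

(** The exchange of roles: an ordering of [sigma] that is antiproper has the same
    chain as a proper ordering of [tau'] and, by sorting, as some ordering of
    [tau]. *)
Lemma opposite_in_sphere tau sigma tau' : nchf tau -> nchf sigma ->
  #|tau| = #|sigma| -> #|tau'| = #|sigma| -> in_sphere tau sigma ->
  opposite sigma tau' -> in_sphere tau' tau.
Proof.
move=> nct ncs ets e' R op t pt ot.
have [s [ps os m]] := op t pt ot.
have [t0 pt0 m0] := in_sphere_antiproper nct ncs ets R ps os.
exists t0 => //; rewrite matched_zipC in m0; last first.
  by rewrite (perm_enum_size ps) (perm_enum_size pt0).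
apply: matched_zip_trans m m0.
  by rewrite (perm_enum_size ps) (perm_enum_size pt).
by rewrite (perm_enum_size ps) (perm_enum_size pt0).
Qed.

End Opposite.

(** * Hyperforests *)

Lemma mem_unzip_split (S T : eqType) (k : S) (l : seq (S * T)) :
  k \in unzip1 l -> exists l1 u l2, l = l1 ++ (k, u) :: l2.
Proof.
case/mapP=> -[k' u] kl /= ->; case/splitPr: kl => l1 l2.
by exists l1, u, l2.
Qed.

Lemma mem_unzip2_split (S T : eqType) (u : T) (l : seq (S * T)) :
  u \in unzip2 l -> exists l1 k l2, l = l1 ++ (k, u) :: l2.
Proof.
case/mapP=> -[k u'] kl /= ->; case/splitPr: kl => l1 l2.
by exists l1, k, l2.
Qed.

Section Hyperforests.
Variable n : nat.
Implicit Types (X Y tau sigma : {set {set 'I_n.+1}}) (e f p : {set 'I_n.+1})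
  (x y v u : 'I_n.+1) (l : seq ({set 'I_n.+1} * 'I_n.+1)).

(** The entries of the list are the successive hyperedges, each with the vertex
    by which it is left. *)
Fixpoint walk X x l : bool :=
  if l is (p, u) :: l' then [&& p \in X, x \in p, u \in p & walk X u l'] else true.

Lemma walk_cat X x l1 p u l2 :
  walk X x (l1 ++ (p, u) :: l2) -> u \in p /\ walk X u l2.
Proof.
by elim: l1 x => [|[q v] l IH] x /= => [/and4P[]|/and4P[_ _ _ /IH]].
Qed.

(** Cutting out detours makes both the vertices and the hyperedges of a walk
    distinct. *)
Lemma conn_walk X x y : conn X x y -> exists l,
  [/\ walk X x l, uniq (unzip1 l), uniq (x :: unzip2 l) & last x (unzip2 l) = y].
Proof.
rewrite conn_sym; apply: (conn_ind (P := fun x => exists l,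
  [/\ walk X x l, uniq (unzip1 l), uniq (x :: unzip2 l) & last x (unzip2 l) = y])).
  by exists [::].
move=> e {}x z eX xe ze [l [wl u1 u2 lst]].
have [<-|nzx] := eqVneq x z; first by exists l.
have [zl|zl] := boolP (z \in unzip2 l).
  have [l1 [p [l2 el]]] := mem_unzip2_split zl; rewrite {l zl}el in wl u1 u2 lst.
  have [zp wl2] := walk_cat wl; exists l2; split=> //.
  - by move: u1; rewrite /unzip1 map_cat cat_uniq /= => /and3P[_ _ /andP[]].
  - move: u2; rewrite -cat1s /unzip2 map_cat catA cat_uniq => /and3P[_ _].
    exact.
  by move: lst; rewrite /unzip2 map_cat last_cat.
have [el|el] := boolP (e \in unzip1 l).
  have [l1 [u [l2 el']]] := mem_unzip_split el; rewrite {l el}el' in wl u1 u2 lst zl.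
  have [ue wl2] := walk_cat wl; exists ((e, u) :: l2); split=> /=.
  - by rewrite eX ze ue wl2.
  - by move: u1; rewrite /unzip1 map_cat cat_uniq /= => /and3P[_ _].
  - move: u2 zl; rewrite -cat1s /unzip2 map_cat catA cat_uniq mem_cat negb_or.
    by move=> /and3P[_ _ /= ->] /andP[_ ->].
  by move: lst; rewrite /unzip2 map_cat last_cat.
exists ((e, x) :: l); split=> //=.
- by rewrite eX xe ze wl.
- by rewrite el.
by rewrite inE negb_or eq_sym nzx zl; move: u2 => /= ->.
Qed.

Lemma walk_nth X x l i e0 x0 : walk X x l -> i < size l ->
  [/\ nth e0 (unzip1 l) i \in X, nth x0 (x :: unzip2 l) i \in nth e0 (unzip1 l) i &
      nth x0 (unzip2 l) i \in nth e0 (unzip1 l) i].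
Proof.
elim: l x i => [|[p u] l IH] x [|i] //= /and4P[pX xp up wl]; first by [].
by rewrite ltnS => ltil; apply: IH.
Qed.

Lemma walk_sub X x l : walk X x l -> {subset unzip1 l <= X}.
Proof.
elim: l x => [|[p u] l IH] x //= /and4P[pX _ _ /IH sl] e.
by rewrite inE => /orP[/eqP->|/sl].
Qed.

(** The vertices around a simple cycle connect two vertices of its first hyperedge
    without this hyperedge. *)
Lemma bridged_acyclic X : bridged X -> ~ has_simple_cycle X.
Proof.
move=> bX [k [v [e [k2 injv inje cyc_e]]]].
case: k k2 v e injv inje cyc_e => // k k1 v e injv inje cyc_e.
have [e0X v0e v1e] := cyc_e ord0.
have ord_succ m (ltm : m < k.+1) (ltm1 : m.+1 < k.+1) :
    ordS (Ordinal ltm) = Ordinal ltm1.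
  by apply: val_inj; rewrite /= modn_small.
have along m : m < k -> conn (X :\ e ord0) (v (ordS ord0)) (v (inord m.+1)).
  elim: m => [|m IH] ltm.
    suff -> : inord 1 = ordS ord0 :> 'I_k.+1 by apply: conn_refl.
    by apply: val_inj; rewrite /= inordK ?modn_small.
  apply: conn_trans (IH (ltnW ltm)) _.
  have [eX ve ve'] := cyc_e (inord m.+1); apply: conn_edge ve _.
    rewrite !inE eX andbT; apply/eqP=> /inje/(congr1 val) /=.
    by rewrite inordK // ltnS ltnW.
  suff <- : ordS (inord m.+1) = inord m.+2 :> 'I_k.+1 by [].
  by apply: val_inj; rewrite /= !inordK ?modn_small // ltnS ltnW.
have {}along : conn (X :\ e ord0) (v (ordS ord0)) (v ord0).
  case: k => [|k] in k1 v e injv inje cyc_e e0X v0e v1e ord_succ along *; first by [].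
  apply: conn_trans (along k (ltnSn k)) _.
  have [eX ve ve'] := cyc_e (inord k.+1); apply: conn_edge ve _.
    by rewrite !inE eX andbT; apply/eqP=> /inje/(congr1 val); rewrite /= inordK.
  suff <- : ordS (inord k.+1) = ord0 :> 'I_k.+2 by [].
  by apply: val_inj; rewrite /= inordK // modnn.
have := bX _ _ _ e0X v1e v0e along => /injv/(congr1 val) /=.
by rewrite modn_small.
Qed.

Lemma acyclic_bridged X : ~ has_simple_cycle X -> bridged X.
Proof.
move=> acX e x y eX xe ye /conn_walk[l [wl u1 u2 lst]].
have [//|nxy] := eqVneq x y; case: acX.
have szl : 0 < size l by case: l lst {wl u1 u2} => //= exy; rewrite exy eqxx in nxy.
have se : {subset unzip1 l <= X :\ e} := walk_sub wl.
have s1 : size (unzip1 l) = size l by rewrite size_map.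
have s2 : size (x :: unzip2 l) = (size l).+1 by rewrite /= size_map.
exists (size l).+1, (fun i => nth x (x :: unzip2 l) i),
  (fun i => nth e (unzip1 l) i); split=> //.
- move=> i j; move/eqP; rewrite nth_uniq ?s2 ?ltn_ord // => /eqP.
  exact: val_inj.
- have big (i : 'I_(size l).+1) : ~~ (i < size l) -> i = size l :> nat.
    by have := ltn_ord i; rewrite ltnS leq_eqVlt => /orP[/eqP|->].
  have inl (i : 'I_(size l).+1) : i < size l -> nth e (unzip1 l) i != e.
    move=> lti; have /se : nth e (unzip1 l) i \in unzip1 l by rewrite mem_nth ?s1.
    by rewrite !inE => /andP[].
  have out (i : 'I_(size l).+1) : ~~ (i < size l) -> nth e (unzip1 l) i = e.
    by move=> nlt; rewrite nth_default // s1 leqNgt.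
  move=> i j; have [lti|nlti] := boolP (i < size l);
    have [ltj|nltj] := boolP (j < size l).
  + by move/eqP; rewrite nth_uniq ?s1 // => /eqP/val_inj.
  + by rewrite (out j) // => eqe; move: (inl i lti); rewrite eqe eqxx.
  + by rewrite (out i) // => eqe; move: (inl j ltj); rewrite -eqe eqxx.
  by move=> _; apply: val_inj; rewrite /= (big i) // (big j).
move=> i; have [lti|nlti] := boolP (i < size l).
  have [pX xp up] := walk_nth e x wl lti.
  split=> //; first by move: pX; rewrite !inE => /andP[].
  by rewrite /= modn_small ?ltnS.
have ei : i = size l :> nat.
  by have := ltn_ord i; rewrite ltnS leq_eqVlt => /orP[/eqP|lt]; rewrite ?lt in nlti *.
rewrite /= ei modnn nth_default ?s1 //; split=> //=.
by rewrite -(size_map snd) -/(unzip2 l) nth_last /= lst.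
Qed.

Lemma hyperforestP X : hyperforest X <-> hypergraph X /\ bridged X.
Proof.
split=> [[hX aX]|[hX bX]]; split=> //; [exact: acyclic_bridged|exact: bridged_acyclic].
Qed.

(** A hyperedge with [k] vertices merges [k] blocks into one. *)
Lemma card_components X : hypergraph X -> bridged X ->
  #|components X| + \sum_(e in X) #|e|.-1 = n.+1.
Proof.
have blockE Z x : [set y | conn Z x y] \in components Z.
  by apply/mem_components; exists x.
have blockP Z x y : ([set z | conn Z x z] == [set z | conn Z y z]) = conn Z x y.
  apply/eqP/idP => [/setP/(_ y)|xy]; first by rewrite !inE conn_refl.
  apply/setP=> z; rewrite !inE; apply/idP/idP; apply: conn_trans => //.
  by rewrite conn_sym.
have [m] := ubnP #|X|; elim: m X => // m IH X ltXm hX bX.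
have [X0|[e eX]] := set_0Vmem X.
  rewrite {1}X0 X0 big_set0 addn0; suff -> : components set0 = [set [set x] | x : 'I_n.+1].
    by rewrite card_imset ?card_ord //; apply: set1_inj.
  have c0 x : [set y | conn set0 x y] = [set x].
    apply/setP=> y; rewrite !inE; apply/idP/eqP => [|->]; last exact: conn_refl.
    by apply: (conn_ind (P := fun y => y = x)) => // f u v; rewrite inE.
  apply/setP=> B; apply/mem_components/imsetP => [[x ->]|[x _ ->]]; exists x => //.
have sXe := subD1set X e.
have {}IH : #|components (X :\ e)| + \sum_(f in X :\ e) #|f|.-1 = n.+1.
  apply: IH.
  - by rewrite (cardsD1 e) eX in ltXm.
  - by move=> f /setD1P[_ /hX].
  move=> f x y /setD1P[nfe fX] xf yf xy; apply: (bX f) => //.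
  by apply: conn_mono xy; apply: setSD.
apply: etrans IH; rewrite (big_setD1 e eX) /= addnA; congr (_ + _).
have e2 := hX e eX; have [v ve] : exists v, v \in e by apply/card_gt0P; apply: leq_trans e2.
pose touched := [set [set y | conn (X :\ e) x y] | x in e].
have card_touched : #|touched| = #|e|.
  apply: card_in_imset => x y xe ye /eqP; rewrite blockP; exact: bX.
have sub_touched : touched \subset components (X :\ e).
  by apply/subsetP=> _ /imsetP[x _ ->].
have connE x y : conn X x y <-> conn (X :\ e) x y \/
    exists a b, [/\ a \in e, b \in e, conn (X :\ e) x a & conn (X :\ e) b y].
  split=> [|[xy|[a [b [ae be xa bY]]]]]; first by rewrite -{1}(setD1K eX); apply: connU1.
    exact: conn_mono xy.
  apply: conn_trans (conn_mono sXe xa) _.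
  exact: conn_trans (conn_edge eX ae be) (conn_mono sXe bY).
have -> : components X = [set y | conn X v y] |: (components (X :\ e) :\: touched).
  have untouched x : ~~ conn X v x ->
      [set y | conn X x y] = [set y | conn (X :\ e) x y].
    move=> nvx; apply/setP=> y; rewrite !inE; apply/idP/idP; last exact: conn_mono.
    case/connE=> // -[a [b [ae _ xa _]]]; case/negP: nvx.
    by rewrite conn_sym; apply: conn_trans (conn_mono sXe xa) (conn_edge eX ae ve).
  apply/setP=> B; rewrite !inE; apply/mem_components/idP => [[x ->]|].
    have [vx|nvx] := boolP (conn X v x).
      by rewrite eq_sym blockP vx.
    rewrite untouched // blockE andbT; apply/orP; right.
    apply: contra nvx => /imsetP[a ae /eqP]; rewrite blockP => xa.
    by rewrite conn_sym; apply: conn_trans (conn_mono sXe xa) (conn_edge eX ae ve).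
  case/orP=> [/eqP->|/andP[nt /mem_components[x eB]]]; first by exists v.
  exists x; rewrite {B}eB in nt *; rewrite untouched //.
  apply: contra nt => /connE[vx|[a [b [_ be _ bx]]]]; apply/imsetP.
    by exists v => //; apply/eqP; rewrite blockP conn_sym.
  by exists b => //; apply/eqP; rewrite blockP conn_sym.
rewrite cardsU1 cardsD (setIidPr sub_touched) card_touched.
have le := subset_leq_card sub_touched; rewrite card_touched in le.
suff -> : [set y | conn X v y] \notin components (X :\ e) :\: touched.
  rewrite add1n; move: e2 le; move: #|e| #|components _| => k c; lia.
rewrite !inE negb_and negbK; apply/orP; right.
have [y ye nyv] : exists2 y, y \in e & y != v by apply: exists_other hX eX.
apply/negP=> /mem_components[x eB].
have : v \in [set y | conn X v y] by rewrite inE conn_refl.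
have : y \in [set y | conn X v y] by rewrite inE; apply: conn_edge eX ve ye.
rewrite eB !inE => xy xv; case/eqP: nyv; apply: (bX e) => //.
by apply: conn_trans xv; rewrite conn_sym.
Qed.

Lemma hypertree_components X : connected_hypergraph X -> components X = [set [set: 'I_n.+1]].
Proof.
move=> cX; apply/setP=> B; rewrite inE; apply/mem_components/eqP => [[x ->]|->].
  by apply/setP=> y; rewrite !inE; apply: cX.
by exists ord0; apply/setP=> y; rewrite !inE; symmetry; apply: cX.
Qed.

(** By [card_components], the numbers [#|e|.-1 >= 1] add up to [n]. *)
Lemma tree_card X : tree X <-> hypertree X /\ #|X| = n.
Proof.
have sumE : hypertree X -> \sum_(e in X) #|e|.-1 = n.
  case=> /hyperforestP[hX bX] cX; have := card_components hX bX.
  by rewrite hypertree_components // cards1 => -[].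
split=> [[hX X2]|[hX cX]]; split=> //.
  rewrite -[RHS](sumE hX) -sum1_card; apply: eq_bigr => e eX.
  by rewrite X2.
move=> e eX; have [/hyperforestP[gX _] _] := hX.
have pos f : f \in X -> 0 < #|f|.-1 by move/gX; case: #|f| => // -[].
have : #|e|.-1 = 1.
  apply/eqP; rewrite eqn_leq pos // andbT leqNgt; apply/negP=> gt1.
  have := etrans (sumE hX) (esym cX).
  rewrite -sum1_card (bigD1 e) //= [RHS](bigD1 e) //=.
  have : \sum_(f in X | f != e) 1 <= \sum_(f in X | f != e) #|f|.-1.
    by apply: leq_sum => f /andP[/pos].
  move: gt1; move: #|e|.-1 (\sum_(f in X | f != e) 1) (\sum_(f in X | f != e) #|f|.-1) => k a b.
  by lia.
by have := gX e eX; case: #|e| => // k _ /= ->.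
Qed.

End Hyperforests.

(** * Chains of partitions *)

Section Chains.
Variable n : nat.
Implicit Types (X Y tau sigma : {set {set 'I_n.+1}}) (e f : {set 'I_n.+1})
  (s t : seq {set 'I_n.+1}) (P Q : {set {set 'I_n.+1}}).
Local Opaque components.

Definition prefix_blocks s j : {set {set 'I_n.+1}} := components [set:: take j s].

Definition chain_seq s : seq {set {set 'I_n.+1}} :=
  [seq prefix_blocks s j | j <- iota 1 (size s).-1].

Definition strict_refines P Q : bool := refines P Q && ~~ refines Q P.

Lemma refines_trans : transitive (@refines n).
Proof.
move=> Q P P' /forall_inP rPQ /forall_inP rQP'; apply/forall_inP=> B /rPQ.
case/existsP=> C /andP[/rQP'/existsP[D /andP[DP' CD]] BC].
by apply/existsP; exists D; rewrite DP' (subset_trans BC).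
Qed.

Lemma strict_refines_trans : transitive strict_refines.
Proof.
move=> Q P P' /andP[rPQ nQP] /andP[rQP' _]; apply/andP; split.
  exact: refines_trans rPQ rQP'.
by apply: contraNN nQP => /(refines_trans rQP').
Qed.

Lemma strict_refines_irr : irreflexive strict_refines.
Proof. by move=> P; rewrite /strict_refines andbN. Qed.

Lemma mem_chain_of s : chain_of s =i chain_seq s.
Proof.
move=> P; apply/imsetP/mapP => [[j]|[j]].
  rewrite inE => j0 ->; exists (j : nat) => //.
  by rewrite mem_iota j0 /=; have := ltn_ord j; lia.
rewrite mem_iota => /andP[j0 ltj] ->.
have ltjs : j < size s by move: j0 ltj; lia.
by exists (Ordinal ltjs); rewrite ?inE.
Qed.

Section Strict.
Variable tau : {set {set 'I_n.+1}}.
Hypothesis (nct : nchf tau).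

Lemma prefix_nchf s j : {subset s <= tau} -> nchf [set:: take j s].
Proof.
move=> ss; apply: nchf_sub nct; apply/subsetP=> e; rewrite inE => /mem_take.
exact: ss.
Qed.

Lemma prefix_conn s i j : i <= j -> subrel (conn [set:: take i s]) (conn [set:: take j s]).
Proof.
move=> leij x y; apply: conn_mono; apply/subsetP=> e; rewrite !inE.
by rewrite -(minn_idPl leij) take_min; apply: mem_take.
Qed.

(** The first hyperedge outside the shorter prefix merges blocks. *)
Lemma prefix_merge s i j : {subset s <= tau} -> uniq s -> i < j <= size s ->
  exists x y, conn [set:: take j s] x y && ~~ conn [set:: take i s] x y.
Proof.
move=> ss us /andP[ltij lejs]; have ltis : i < size s by apply: leq_trans lejs.
set e := nth set0 s i; have es : e \in s by apply: mem_nth.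
have [x xe _] := exists_other ord0 (nchf_hypergraph nct) (ss e es).
have [y ye nyx] := exists_other x (nchf_hypergraph nct) (ss e es).
exists x, y; apply/andP; split.
  apply: (conn_edge (e := e)) => //; rewrite inE /e -(nth_take set0 ltij).
  by apply: mem_nth; rewrite size_take; case: ifP.
apply: contraNN nyx => xy; apply/eqP/esym.
apply: (bridged_touch (nchf_bridged nct) _ (ss e es) _ xe ye xy).
  by apply/subsetP=> f; rewrite inE => /mem_take/ss.
rewrite inE in_take // -leqNgt; by rewrite index_uniq.
Qed.

Lemma prefix_strict s i j : {subset s <= tau} -> uniq s -> i < j <= size s ->
  strict_refines (prefix_blocks s i) (prefix_blocks s j).
Proof.
move=> ss us lt; have [ltij _] := andP lt; apply/andP; split.
  by apply/refines_components/prefix_conn/ltnW.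
apply/negP=> /refines_components sub.
have [x [y /andP[xy /negP]]] := prefix_merge ss us lt; apply; exact: sub.
Qed.

Lemma chain_seq_sorted s : {subset s <= tau} -> uniq s ->
  sorted strict_refines (chain_seq s).
Proof.
move=> ss us; rewrite /chain_seq sorted_map.
apply: (@sub_in_sorted _ (gtn (size s)) ltn); last exact: iota_ltn_sorted.
  move=> i j _ ltj ltij; apply: prefix_strict => //; apply/andP; split=> //.
  exact: ltnW.
by apply/allP=> j; rewrite mem_iota inE; lia.
Qed.

Lemma card_chain_of s : {subset s <= tau} -> uniq s -> #|chain_of s| = (size s).-1.
Proof.
move=> ss us; rewrite (eq_card (mem_chain_of s)).
have /card_uniqP -> := sorted_uniq strict_refines_trans strict_refines_irr
  (chain_seq_sorted ss us).
by rewrite size_map size_iota.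
Qed.

End Strict.

(** The partitions of a chain are strictly sorted by refinement, so that equal
    sets of partitions come from equal lists. *)
Lemma chain_of_sub tau sigma s t : nchf tau -> nchf sigma ->
  {subset s <= tau} -> {subset t <= sigma} -> uniq s -> uniq t ->
  size s = size t -> chain_of s \subset chain_of t ->
  forall j, j < size s -> prefix_blocks s j = prefix_blocks t j.
Proof.
move=> nct ncs ss st us ut est sub.
have eqc : chain_of s = chain_of t.
  apply/eqP; rewrite eqEcard sub.
  by rewrite (card_chain_of nct ss us) (card_chain_of ncs st ut) est leqnn.
have eqs : chain_seq s = chain_seq t.
  apply: (irr_sorted_eq strict_refines_trans strict_refines_irr).
  - exact: (chain_seq_sorted nct ss us).
  - exact: (chain_seq_sorted ncs st ut).
  by move=> P; rewrite -!mem_chain_of eqc.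
case=> [|j] ltj; first by rewrite /prefix_blocks !take0.
have := congr1 (nth set0 ^~ j) eqs.
rewrite !(nth_map 0) ?size_iota ?nth_iota -?est //; lia.
Qed.

Lemma matched_rev s t : size s = size t ->
  matched (zip (rev s) (rev t)) <->
  forall j, j <= size s -> prefix_blocks s j = prefix_blocks t j.
Proof.
have [m] := ubnP (size s); elim: m s t => // m IH s t.
case/lastP: s => [|s e]; case/lastP: t => [|t f].
- by move=> _ _; split=> // _ j; rewrite leqn0 => /eqP ->.
- by rewrite size_rcons.
- by rewrite size_rcons.
rewrite !size_rcons !rev_rcons ltnS => lts [est].
rewrite matched_cons ?size_rev //.
have tk s' e' j : j <= size s' -> prefix_blocks (rcons s' e') j = prefix_blocks s' j.
  by move=> lej; rewrite /prefix_blocks -cats1 take_cat; case: ltngtP lej => // ->;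
     rewrite ?subnn take_size ?cats0.
have last s' e' : prefix_blocks (rcons s' e') (size s').+1 = components [set:: e' :: rev s'].
  rewrite /prefix_blocks -(size_rcons s' e') take_size; congr components.
  by apply: eq_set_perm; rewrite -rev_rcons perm_sym perm_rev.
split=> [/andP[/eqP eQ /(IH _ _ lts est) eP] j|eP].
  rewrite leq_eqVlt ltnS => /orP[/eqP->|lej]; first by rewrite last est last.
  by rewrite !tk -?est //; apply: eP.
rewrite -!last -est eP // eqxx; apply/(IH _ _ lts est) => j lej.
by rewrite -(tk s e) // -(tk t f) -?est //; apply/eP/leqW.
Qed.

Lemma chain_of_matched s t : size s = size t -> matched (zip (rev s) (rev t)) ->
  chain_of s = chain_of t.
Proof.
move=> est /(matched_rev est) eP; apply/setP=> P; rewrite !mem_chain_of /chain_seq -est.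
apply/mapP/mapP => -[j]; rewrite mem_iota => /andP[j0 ltj] ->; exists j;
  rewrite ?mem_iota ?j0 // eP //; move: ltj j0; lia.
Qed.

End Chains.

From mathcomp Require Import all_order all_algebra.
From mathcomp Require Import boolp classical_sets functions reals convex.
From mathcomp Require Import interval_inference ring.

Import Order.TTheory GRing.Theory Num.Theory.

(** * Convex hulls of vertices of a convex polygon *)

Section Geometry.
Variables (R : realType) (n : nat) (p : 'I_n.+1 -> 'rV[R]_2).
Hypotheses (n2 : (2 <= n)%N) (pconv : convex_polygon p).
Implicit Types (a b c d x y v w : 'I_n.+1) (e f : {set 'I_n.+1}) (z : 'rV[R]_2).
Local Open Scope ring_scope.

Lemma signed_areaC (z1 z2 z3 : 'rV[R]_2) :
  signed_area z1 z2 z3 = signed_area z2 z3 z1.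
Proof. by rewrite /signed_area; ring. Qed.

Lemma signed_areaN (z1 z2 z3 : 'rV[R]_2) :
  signed_area z1 z2 z3 = - signed_area z1 z3 z2.
Proof. by rewrite /signed_area; ring. Qed.

Lemma cyc_area a b c : cyc a b c -> signed_area (p a) (p b) (p c) < 0.
Proof.
case/or3P=> h; first exact: pconv.
  by rewrite signed_areaC; apply: pconv.
by rewrite -signed_areaC; apply: pconv.
Qed.

Lemma area_eq0 a b v : a != b -> signed_area (p a) (p b) (p v) = 0 ->
  v = a \/ v = b.
Proof.
move=> nab area0; have [->|nva] := eqVneq v a; first by left.
have [->|nvb] := eqVneq v b; first by right.
have [/cyc_area|] := boolP (cyc a b v); first by rewrite area0 ltxx.
move/cycN=> c1; have {}c1 : cyc a v b by apply: c1; rewrite // eq_sym.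
by have := cyc_area c1; rewrite signed_areaN area0 oppr0 ltxx.
Qed.

Lemma polygon_inj : injective p.
Proof.
move=> a b eab; apply/eqP; apply: contraT => nab.
have [v nv] : exists v, v \notin [set a; b].
  apply/existsP; rewrite -negb_forall; apply/negP=> /forallP all.
  have : (#|[set: 'I_n.+1]| <= #|[set a; b]|)%N.
    by apply/subset_leq_card/fintype.subsetP=> v _; apply: all.
  by rewrite cardsT card_ord cards2 nab; case: n n2 => [|[]].
have area0 : signed_area (p a) (p b) (p v) = 0.
  by rewrite /signed_area eab; ring.
by case: (area_eq0 nab area0) nv => ->; rewrite !inE eqxx ?orbT.
Qed.

Lemma hull_sub e (A : set 'rV[R]_2) : @convex_set R 'rV[R]_2 A ->
  (forall v, v \in e -> A (p v)) -> (hull p e `<=` A)%classic.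
Proof. by move=> cA eA; apply: smallest_sub => // _ [v /= ve <-]; apply: eA. Qed.

Lemma hull_vertex e v : v \in e -> hull p e (p v).
Proof. by move=> ve; apply: sub_gen_smallest; exists v. Qed.

Lemma hull_convex e z1 z2 (s t : R) : hull p e z1 -> hull p e z2 ->
  0 <= s -> 0 <= t -> s + t = 1 -> hull p e (s *: z1 + t *: z2).
Proof.
move=> h1 h2 s0 t0 st A [cA pA]; have s1 : s <= 1 by rewrite -st lerDl.
have := cA z1 z2 (Itv01 s0 s1).
rewrite !inE => /(_ (h1 A (conj cA pA)) (h2 A (conj cA pA))).
suff -> : t = 1 - s by [].
by rewrite -st [s + t]addrC addrK.
Qed.

Lemma convex_setI (A : set 'rV[R]_2) :
  (forall z1 z2 (s t : R), A z1 -> A z2 -> 0 < s -> 0 < t -> s + t = 1 ->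
     A (s *: z1 + t *: z2)) -> @convex_set R 'rV[R]_2 A.
Proof.
move=> cA; apply/convex_setW => z1 z2; rewrite !inE => A1 A2 k k0 k1.
rewrite inE; apply: (cA z1 z2) => //; first by rewrite subr_gt0.
by rewrite addrC subrK.
Qed.

(** The weights of the intersection point of the diagonals [ac] and [bd] are
    given by areas of triangles. It is not a vertex, as a vertex on both lines
    would be an end of both diagonals. *)
Lemma crossing_point a b c d e f : a \in e -> c \in e -> b \in f -> d \in f ->
  cyc a b c -> cyc a c d -> exists z, [/\ hull p e z, hull p f z &
    forall v, z != p v].
Proof.
move=> ae ce bf df abc acd.
have [nab nbc nac] := cyc_neq abc; have [_ ncd nad] := cyc_neq acd.
have nbd : b != d.
  by apply: contraL (cyc_asym abc) => /eqP ->; rewrite negbK acd.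
pose A z := signed_area (p a) (p c) z; pose B z := signed_area (p b) (p d) z.
have Ab : 0 < A (p b) by rewrite /A signed_areaN oppr_gt0 cyc_area.
have Ad : A (p d) < 0 by rewrite /A cyc_area.
have Ba : B (p a) < 0.
  by rewrite /B cyc_area // -cycC; apply: cyc_trans acd.
have Bc : 0 < B (p c).
  rewrite /B signed_areaN oppr_gt0 cyc_area //; exact: cyc_shift abc acd.
have D0 : 0 < A (p b) - A (p d) by rewrite subr_gt0 (lt_trans Ad).
have E0 : 0 < B (p c) - B (p a) by rewrite subr_gt0 (lt_trans Ba).
have DE : A (p b) - A (p d) = B (p c) - B (p a).
  by rewrite /A /B /signed_area; ring.
set D := A (p b) - A (p d) in D0 DE.
pose z := (- A (p d) / D) *: p b + (A (p b) / D) *: p d.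
have ez : z = (B (p c) / D) *: p a + (- B (p a) / D) *: p c.
  have Dn0 : D != 0 by rewrite gt_eqF.
  apply/rowP=> i; rewrite !mxE ![_ / D]mulrC -!mulrA -!mulrDr; congr (_ * _).
  rewrite /A /B /signed_area; case: i => -[|[|//]] lti.
    by rewrite (_ : Ordinal lti = 0) /=; [ring|apply: val_inj].
  by rewrite (_ : Ordinal lti = 1) /=; [ring|apply: val_inj].
have Dn0 : D != 0 by rewrite gt_eqF.
have Dge0 : 0 <= D by rewrite ltW.
exists z; split.
- rewrite ez; apply: hull_convex; try exact: hull_vertex.
  + by apply: divr_ge0 => //; apply: ltW.
  + by apply: divr_ge0 => //; rewrite oppr_ge0 ltW.
  by rewrite -mulrDl -DE divff.
- apply: hull_convex; try exact: hull_vertex.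
  + by apply: divr_ge0 => //; rewrite oppr_ge0 ltW.
  + by apply: divr_ge0 => //; apply: ltW.
  by rewrite -mulrDl addrC divff.
move=> v; apply/eqP=> ezv.
have lin (z1 z2 z3 z4 : 'rV[R]_2) (s t : R) : s + t = 1 ->
    signed_area z1 z2 (s *: z3 + t *: z4) =
    s * signed_area z1 z2 z3 + t * signed_area z1 z2 z4.
  move=> st; have -> : s = 1 - t by rewrite -st addrK.
  by rewrite /signed_area !mxE; ring.
have Az : A z = 0.
  rewrite /A lin; last by rewrite -mulrDl addrC divff.
  by rewrite -/(A (p b)) -/(A (p d)); field.
have Bz : B z = 0.
  rewrite ez /B lin; last by rewrite -mulrDl -DE divff.
  by rewrite -/(B (p a)) -/(B (p c)); field.
rewrite {}ezv in Az Bz.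
have [[eva|evc] [evb|evd]] := (area_eq0 nac Az, area_eq0 nbd Bz).
- by rewrite -eva -evb eqxx in nab.
- by rewrite -eva -evd eqxx in nad.
- by rewrite -evc -evb eqxx in nbc.
by rewrite -evc -evd eqxx in ncd.
Qed.

Lemma crossing_hulls e f a c b d : a \in e -> c \in e -> b \in f -> d \in f ->
  chords_cross a c b d -> exists z, [/\ hull p e z, hull p f z &
    forall v, z != p v].
Proof.
move=> ae ce bf df; case/and5P=> nac nba nbc nda /andP[ndc].
case: (boolP (cyc a b c)) (boolP (cyc a d c)) => abc [] adc // _.
  by apply: crossing_point abc (cycN _ _ _ adc); rewrite // eq_sym.
have abc' := cycN _ _ _ abc; apply: (crossing_point ae ce df bf adc).
by apply: abc'; rewrite // eq_sym.
Qed.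

(** The neighbours [l] and [r] of [x] on [f] span a line that separates [f] from
    the vertices of [e] outside [f]. *)
Lemma separating_chord e f x : x \in e -> x \notin f -> (1 < #|f|)%N ->
  (forall a c b d, a \in e -> c \in e -> b \in f -> d \in f ->
     ~~ chords_cross a c b d) ->
  exists l r, [/\ l \in f, r \in f, l != r,
    forall u, u \in f -> u != l -> u != r -> cyc l r u &
    forall y, y \in e -> y != l -> y != r -> cyc l y r].
Proof.
move=> xe xf f2 nc; have [u0 u0f] : exists u, u \in f.
  by apply/card_gt0P; apply: ltnW.
have nx u : u \in f -> u != x by move=> uf; apply: contraNneq xf => <-.
case: (@arg_minnP _ u0 (mem f) (clockwise_dist x) u0f) => r rf minr.
case: (@arg_maxnP _ u0 (mem f) (clockwise_dist x) u0f) => l lf maxl.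
have far u v : u \in f -> v \in f -> (clockwise_dist x u <= clockwise_dist x v)%N ->
    u != v -> cyc x u v.
  move=> uf vf; rewrite leqNgt ltn_clockwise_dist ?nx // => nvu nuv.
  by apply: cycN nvu; rewrite eq_sym; [apply: (nx v vf)|apply: nuv|apply: (nx u uf)].
have nlr : l != r.
  apply: contraTneq f2 => elr; rewrite -leqNgt -(cards1 r).
  apply/subset_leq_card/fintype.subsetP=> u uf; rewrite inE.
  apply: contraT => nur; have nru : r != u by rewrite eq_sym.
  case/negP: (cyc_asym (far r u rf uf (minr u uf) nru)).
  by rewrite -elr; apply: far (maxl u uf) _ => //; rewrite elr.
have xrl : cyc x r l by apply: far (minr l lf) _; rewrite // eq_sym.
exists l, r; split=> // [u uf nul nur|y ye nyl nyr].
  have nru : r != u by rewrite eq_sym.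
  rewrite cycC; apply: (cyc_shift (far r u rf uf (minr u uf) nru)).
  exact: far (maxl u uf) nul.
apply: (@cyc_side l r x y) => //; last by rewrite cycC.
- by rewrite chords_crossC; apply: nc.
- by rewrite eq_sym; apply: (nx l lf).
by rewrite eq_sym; apply: (nx r rf).
Qed.

Lemma area_convex (s t : R) (z1 z2 z3 z4 : 'rV[R]_2) : s + t = 1 ->
  signed_area z1 z2 (s *: z3 + t *: z4) =
  s * signed_area z1 z2 z3 + t * signed_area z1 z2 z4.
Proof.
move=> st; have -> : s = 1 - t by rewrite -st addrK.
by rewrite /signed_area !mxE; ring.
Qed.

(** The hull of [f] lies in the closed half plane of the chord, and the hull of
    [e] in the other open one, except for a common vertex. *)
Lemma separated_hulls e f x z : x \in e -> x \notin f -> (1 < #|f|)%N ->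
  (forall v w, v \in e -> v \in f -> w \in e -> w \in f -> v = w) ->
  (forall a c b d, a \in e -> c \in e -> b \in f -> d \in f ->
     ~~ chords_cross a c b d) ->
  hull p e z -> hull p f z -> exists v, [/\ v \in e, v \in f & z = p v].
Proof.
move=> xe xf f2 meet nc; have [l [r [lf rf nlr fside eside]]] :=
  separating_chord xe xf f2 nc.
pose A := signed_area (p l) (p r).
have Al : A (p l) = 0 by rewrite /A /signed_area; ring.
have Ar : A (p r) = 0 by rewrite /A /signed_area; ring.
have fneg : (hull p f `<=` [set z | A z <= 0])%classic.
  apply: hull_sub => [|u uf] /=.
    apply: convex_setI => z1 z2 s t /= A1 A2 s0 t0 st.
    rewrite /A area_convex // -[0]addr0; apply: lerD.
      by apply: mulr_ge0_le0 => //; apply: ltW.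
    by apply: mulr_ge0_le0 => //; apply: ltW.
  have [->|nul] := eqVneq u l; first by rewrite Al.
  have [->|nur] := eqVneq u r; first by rewrite Ar.
  by rewrite ltW // cyc_area // fside.
have epos : (hull p e `<=`
    [set z | 0 < A z \/ exists v, [/\ v \in e, v \in f & z = p v]])%classic.
  have ef0 v : v \in e -> v \in f -> A (p v) = 0.
    move=> ve vf; have [->//|nvl] := eqVneq v l; have [->//|nvr] := eqVneq v r.
    have := cyc_asym (eside v ve nvl nvr).
    by rewrite fside.
  apply: hull_sub => [|y ye] /=.
    apply: convex_setI => z1 z2 s t /= A1 A2 s0 t0 st.
    rewrite /A area_convex // -/(A z1) -/(A z2).
    case: A1 => [A1|[v [ve vf e1]]]; case: A2 => [A2|[w [we wf e2]]].
    - by left; rewrite addr_gt0 // mulr_gt0.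
    - by left; rewrite e2 ef0 // mulr0 addr0 mulr_gt0.
    - by left; rewrite e1 ef0 // mulr0 add0r mulr_gt0.
    right; exists v; split=> //; rewrite e1 e2 (meet w v) // -scalerDl st.
    by rewrite scale1r.
  have [yl|nyl] := eqVneq y l; first by right; exists y; rewrite {2}yl.
  have [yr|nyr] := eqVneq y r; first by right; exists y; rewrite {2}yr.
  by left; rewrite /A signed_areaN oppr_gt0 cyc_area // eside.
by move=> /epos[Az|//] /fneg /=; rewrite leNgt Az.
Qed.

Lemma hull_small e z : (#|e| <= 1)%N -> hull p e z -> exists2 v, v \in e & z = p v.
Proof.
move=> e1; have : (hull p e `<=` [set z | exists2 v, v \in e & z = p v])%classic.
  apply: hull_sub => [|v ve]; last by exists v.
  apply: convex_setI => z1 z2 s t /= [v ve ->] [w we ->] s0 t0 st.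
  exists v => //; have /card_le1_eqP/(_ v w ve we) -> := e1.
  by rewrite -scalerDl st scale1r.
exact.
Qed.

Lemma uncrossed_hulls e f z :
  (forall v w, v \in e -> v \in f -> w \in e -> w \in f -> v = w) ->
  (forall a c b d, a \in e -> c \in e -> b \in f -> d \in f ->
     ~~ chords_cross a c b d) ->
  hull p e z -> hull p f z -> exists v, [/\ v \in e, v \in f & z = p v].
Proof.
move=> meet nc ze zf; have [f1|f2] := leqP #|f| 1.
  have [v vf ezv] := hull_small f1 zf; have [ve|nve] := boolP (v \in e).
    by exists v.
  have [e1|e2] := leqP #|e| 1.
    have [w we] := hull_small e1 ze; rewrite ezv => /polygon_inj evw.
    by rewrite evw we in nve.
  have [||w [wf we ->]] := separated_hulls vf nve e2 _ _ zf ze.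
  - by move=> v' w' v'f v'e w'f w'e; apply: meet.
  - by move=> a c b d af cf be de; rewrite chords_crossC; apply: nc.
  by exists w.
have [/fintype.subsetP sef|] := boolP (e \subset f).
  have [|v ve ->] := @hull_small e z _ ze; last by exists v; rewrite ve sef.
  by apply/card_le1_eqP => v w ve we; apply: meet; rewrite // sef.
case/subsetPn=> x xe xf; exact: (separated_hulls xe xf f2).
Qed.

End Geometry.

(** * Special spheres and tree simplices *)

Section Complexes.
Variables (R : realType) (n : nat) (p : 'I_n.+1 -> 'rV[R]_2).
Hypotheses (n2 : (2 <= n)%N) (pconv : convex_polygon p).
Implicit Types (X tau sigma : {set {set 'I_n.+1}}) (e f : {set 'I_n.+1})
  (s t : seq {set 'I_n.+1}).
Local Opaque components.

(** Bridged hyperedges share at most one vertex, and their hulls meet elsewhere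
    exactly if two of their chords cross. *)
Lemma noncrossingP X : bridged X -> (noncrossing p X <-> uncrossed X).
Proof.
move=> bX; split=> [ncX e f a c b d eX fX nef ae ce bf df|uX e f eX fX nef].
  apply/negP=> /(crossing_hulls pconv ae ce bf df)[z [ze zf nz]].
  case: (ncX e f eX fX nef) => [ef0|[v efv]].
    by have : (hull p e `&` hull p f)%classic z by []; rewrite ef0.
  have : (hull p e `&` hull p f)%classic z by []; rewrite efv => zv.
  by have := nz v; rewrite zv eqxx.
have meet v w : v \in e -> v \in f -> w \in e -> w \in f -> v = w.
  by move=> ve vf we wf; apply: (bridged_inter bX eX fX nef).
have sub := uncrossed_hulls n2 pconv meet (fun a c b d => uX e f a c b d eX fX nef).
have [[v [ve vf]]|none] := pselect (exists v, v \in e /\ v \in f).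
  right; exists v; apply/seteqP; split=> z /= => [[ze zf]|->].
    by have [w [we wf ->]] := sub z ze zf; rewrite (meet w v).
  by split; apply: hull_vertex.
left; apply/seteqP; split=> z //= -[ze zf].
by have [w [we wf _]] := sub z ze zf; apply: none; exists w.
Qed.

Lemma nc_hypertreeP X : nc_hypertree p X <-> nchf X /\ connected_hypergraph X.
Proof.
split=> [[[/hyperforestP[hX bX] cX] /(noncrossingP bX) uX]|[[hX bX uX] cX]] //.
by split; [split=> //; apply/hyperforestP|apply/noncrossingP].
Qed.

Lemma components_nc_partition X : nchf X -> nc_partition p (components X).
Proof.
move=> [hX bX uX]; split; first exact: components_partition.
move=> B C /mem_components[x ->] /mem_components[y ->] nBC.
have nxy : ~~ conn X x y.
  apply: contraNN nBC => xy; apply/eqP/setP=> z; rewrite !inE.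
  by apply/idP/idP; apply: conn_trans; rewrite // conn_sym.
have disj v : conn X x v -> conn X y v -> False.
  by move=> xv yv; case/negP: nxy; apply: conn_trans xv _; rewrite conn_sym.
apply/seteqP; split=> z //= -[zB zC].
have [||v []] := uncrossed_hulls n2 pconv _ _ zB zC.
- by move=> v w; rewrite !inE => xv yv; case: (disj v).
- move=> a c b d; rewrite !inE => xa xc yb yd; apply: (blocks_uncrossed uX).
  + by apply: conn_trans xc; rewrite conn_sym.
  + by apply: conn_trans yd; rewrite conn_sym.
  apply/negP=> ab; apply: (disj b) => //; exact: conn_trans xa ab.
by rewrite !inE => xv yv; case: (disj v).
Qed.

Lemma chain_of_in_link tau s : nchf tau -> perm_eq s (enum tau) ->
  chain_of s \in nc_partition_link p.
Proof.
move=> nct ps; have [us ss] := (perm_enum_uniq ps, perm_enum_sub ps).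
have chP P : P \in chain_of s -> exists2 j, (0 < j < size s)%N & P = prefix_blocks s j.
  rewrite mem_chain_of => /mapP[j]; rewrite mem_iota => lt ->; exists j => //.
  by move: lt; lia.
rewrite inE; apply/andP; split.
  apply/forall_inP=> P /chP[j /andP[j0 ltj] ->]; apply/and3P; split.
  - by apply/asboolP; apply: components_nc_partition; apply: (prefix_nchf nct).
  - have lt0 : (0 < j <= size s)%N by rewrite j0 ltnW.
    have [x [y /andP[xy nxy]]] := prefix_merge nct ss us lt0.
    apply: contraNneq nxy => eP.
    have : [set v | conn [set:: take j s] x v]%SET \in prefix_blocks s j.
      by apply/mem_components; exists x.
    rewrite eP => /imsetP[z _ /setP exz]; have := exz x; have := exz y.
    by rewrite !inE conn_refl xy => /esym/eqP -> /esym/eqP ->; apply: conn_refl.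
  - have lt1 : (j < size s <= size s)%N by rewrite ltj leqnn.
    have [x [y /andP[_ nxy]]] := prefix_merge nct ss us lt1.
    apply: contraNneq nxy => eP.
    have : [set v | conn [set:: take j s] x v]%SET \in prefix_blocks s j.
      by apply/mem_components; exists x.
    by rewrite eP inE => /eqP/setP/(_ y); rewrite !inE.
apply/forall_inP=> P /chP[i _ ->]; apply/forall_inP=> Q /chP[j _ ->].
case: (leqP i j) => [leij|/ltnW leji]; apply/orP; [left|right];
  by apply/refines_components/prefix_conn.
Qed.

Lemma mem_Sphere tau c : reflect (exists2 s, perm_eq s (enum tau) &
    c \in closed_simplex p (chain_of s)) (c \in Sphere p tau).
Proof.
apply: (iffP bigcupP) => [[s ps cs]|[s ps cs]]; first by exists s.
have sz : size s == #|tau| by rewrite (perm_enum_size ps).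
by exists (Tuple sz).
Qed.

Lemma mem_Simplex tau c : nchf tau -> reflect (exists s, [/\ perm_eq s (enum tau),
    ordered false s & c \in closed_simplex p (chain_of s)]) (c \in Simplex p tau).
Proof.
move=> nct; apply: (iffP bigcupP) => [[s ps cs]|[s [ps os cs]]].
  by move: ps; rewrite proper_orderingP // => /andP[ps os]; exists s.
have sz : size s == #|tau| by rewrite (perm_enum_size ps).
by exists (Tuple sz) => //; rewrite proper_orderingP //= ps.
Qed.

Lemma chain_of_sub_matched tau sigma s t : nchf tau -> nchf sigma ->
  connected_hypergraph tau -> connected_hypergraph sigma -> #|tau| = #|sigma| ->
  perm_eq s (enum tau) -> perm_eq t (enum sigma) -> chain_of s \subset chain_of t ->
  matched (zip (rev s) (rev t)).
Proof.
move=> nct ncs ct cs ets ps pt sub.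
have est : size s = size t by rewrite (perm_enum_size ps) (perm_enum_size pt).
apply/matched_rev => // j; rewrite leq_eqVlt => /orP[/eqP->|ltj].
  rewrite /prefix_blocks take_size est take_size.
  by rewrite (set_seq_perm ps) (set_seq_perm pt) !hypertree_components.
by apply: (chain_of_sub nct ncs (perm_enum_sub ps) (perm_enum_sub pt)
  (perm_enum_uniq ps) (perm_enum_uniq pt)).
Qed.

Lemma chain_of_closed tau s : nchf tau -> perm_eq s (enum tau) ->
  chain_of s \in closed_simplex p (chain_of s).
Proof. by move=> nct ps; rewrite inE subxx (chain_of_in_link nct ps). Qed.

(** As all chains of orderings of [tau] and [sigma] have the same length, a chain
    contained in another one is equal to it. *)
Lemma sub_SphereP tau sigma : nchf tau -> nchf sigma ->
  connected_hypergraph tau -> connected_hypergraph sigma -> #|tau| = #|sigma| ->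
  (Simplex p tau \subset Sphere p sigma) <-> in_sphere tau sigma.
Proof.
move=> nct ncs ct cs ets; split=> [/fintype.subsetP sub t pt ot|sub].
  have prt : perm_eq (rev t) (enum tau) by rewrite perm_rev.
  have /sub/mem_Sphere[s ps] : chain_of (rev t) \in Simplex p tau.
    apply/(mem_Simplex _ nct); exists (rev t); split=> //; first by rewrite ordered_rev.
    exact: (chain_of_closed nct prt).
  rewrite inE => /andP[_ subc]; exists (rev s); first by rewrite perm_rev.
  by rewrite -[t]revK; apply: chain_of_sub_matched ets prt ps subc.
apply/fintype.subsetP=> c /(mem_Simplex _ nct)[s [ps os cc]].
have [||t pt m] := sub (rev s); rewrite ?perm_rev ?ordered_rev //.
apply/mem_Sphere; exists (rev t); first by rewrite perm_rev.
suff <- : chain_of s = chain_of (rev t) by [].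
apply: chain_of_matched; last by rewrite revK.
by rewrite size_rev (perm_enum_size ps) (perm_enum_size pt).
Qed.

Lemma dimension_of (K : complex n) tau : nchf tau ->
  (forall c, c \in K -> exists2 s, perm_eq s (enum tau) & c \subset chain_of s) ->
  (exists2 s, perm_eq s (enum tau) & chain_of s \in K) ->
  dimension K = (Posz #|tau|.-1 - 1)%R.
Proof.
move=> nct ub [s ps sK]; rewrite /dimension; congr (Posz _ - 1)%R.
have cardc t : perm_eq t (enum tau) -> #|chain_of t| = #|tau|.-1.
  move=> pt; rewrite (card_chain_of nct (perm_enum_sub pt) (perm_enum_uniq pt)).
  by rewrite (perm_enum_size pt).
apply/eqP; rewrite eqn_leq; apply/andP; split.
  apply/bigmax_leqP => c /ub[t pt /subset_leq_card].
  by rewrite (cardc t pt).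
by rewrite -(cardc s ps); apply: (leq_bigmax_cond (F := fun c : {set _} => #|c|)).
Qed.

Lemma dimension_Sphere tau : nchf tau -> dimension (Sphere p tau) = (Posz #|tau|.-1 - 1)%R.
Proof.
move=> nct; apply: dimension_of => // [c /mem_Sphere[s ps]|].
  by rewrite inE => /andP[_ sub]; exists s.
exists (enum tau) => //; apply/mem_Sphere; exists (enum tau) => //.
exact: (chain_of_closed nct _).
Qed.

Lemma dimension_Simplex tau : nchf tau -> dimension (Simplex p tau) = (Posz #|tau|.-1 - 1)%R.
Proof.
move=> nct; apply: dimension_of => // [c /(mem_Simplex _ nct)[s [ps _]]|].
  by rewrite inE => /andP[_ sub]; exists s.
have [s ps os] := exists_antiproper nct; exists s => //.
by apply/(mem_Simplex _ nct); exists s; split=> //; apply: (chain_of_closed nct ps).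
Qed.

Lemma hypertree_gt0 tau : connected_hypergraph tau -> (0 < #|tau|)%N.
Proof.
move=> ct; rewrite lt0n; apply: contraTneq isT => /cards0_eq t0; exfalso.
have : (@ord0 n : nat) = @ord_max n; last by move: n2 => /=; lia.
congr val; apply: (conn_ind (X := tau) (P := fun y => ord0 = y)) (ct _ _) => //.
by move=> e y z; rewrite t0 inE.
Qed.

Lemma eq_dimension tau sigma : connected_hypergraph tau -> connected_hypergraph sigma ->
  (Posz #|tau|.-1 - 1 = Posz #|sigma|.-1 - 1)%R <-> #|tau| = #|sigma|.
Proof.
move=> /hypertree_gt0 t0 /hypertree_gt0 s0; split=> [/addIr[]|-> //].
by case: #|tau| t0 => // a _; case: #|sigma| s0 => // b _ /= ->.
Qed.

Lemma Simplex_inj tau sigma : nchf tau -> nchf sigma ->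
  connected_hypergraph tau -> connected_hypergraph sigma -> #|tau| = #|sigma| ->
  Simplex p tau = Simplex p sigma -> tau = sigma.
Proof.
move=> nct ncs ct cs ets eS; have [s ps os] := exists_antiproper nct.
have : chain_of s \in Simplex p sigma.
  rewrite -eS; apply/(mem_Simplex _ nct); exists s; split=> //.
  exact: (chain_of_closed nct ps).
case/(mem_Simplex _ ncs)=> t [pt ot]; rewrite inE => /andP[_ sub].
have m := chain_of_sub_matched nct ncs ct cs ets ps pt sub.
suff est : rev s = rev t.
  by rewrite -(set_seq_perm ps) -[s]revK est revK (set_seq_perm pt).
apply: (ordered_unique (d := true) nct ncs) => //.
- by move=> e; rewrite mem_rev; apply: perm_enum_sub.
- by move=> e; rewrite mem_rev; apply: perm_enum_sub.
- by rewrite rev_uniq; apply: perm_enum_uniq ps.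
- by rewrite rev_uniq; apply: perm_enum_uniq pt.
- by rewrite ordered_rev.
- by rewrite ordered_rev.
by rewrite !size_rev (perm_enum_size ps) (perm_enum_size pt).
Qed.

Lemma components1_sub e f : (1 < #|e|)%N ->
  components [set:: [:: e]] = components [set:: [:: f]] -> e \subset f.
Proof.
rewrite !set_seq_cons => e2 /eq_components eC; apply/fintype.subsetP=> x xe.
have /card_gt0P[y /setD1P[nyx ye]] : (0 < #|e :\ x|)%N.
  by move: e2; rewrite (cardsD1 x e) xe.
have : conn (f |: [set:: [::]]) x y by rewrite -eC connU1_edge.
have c0 u v : conn [set:: [::]] u v -> u = v.
  by apply: (conn_ind (P := fun v => u = v)) => // g a b; rewrite inE.
case/connU1=> [/c0 exy|[a [b [af _ /c0 -> _]]]] //.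
by rewrite exy eqxx in nyx.
Qed.

(** In the first partition of an ordering that starts with [e], the only block with
    more than one vertex is [e]. *)
Lemma Sphere_sub tau sigma : nchf tau -> nchf sigma ->
  connected_hypergraph tau -> connected_hypergraph sigma -> #|tau| = #|sigma| ->
  Sphere p tau = Sphere p sigma -> tau \subset sigma.
Proof.
move=> nct ncs ct cs ets eS; apply/fintype.subsetP=> e et.
pose s := e :: enum (tau :\ e).
have ps : perm_eq s (enum tau).
  apply: uniq_perm; rewrite /= ?enum_uniq ?mem_enum ?inE ?eqxx // => f.
  by rewrite inE !mem_enum !inE; case: eqVneq => [->|].
have : chain_of s \in Sphere p sigma.
  by rewrite -eS; apply/mem_Sphere; exists s => //; apply: (chain_of_closed nct ps).
case/mem_Sphere=> t pt; rewrite inE => /andP[_ sub].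
have m := chain_of_sub_matched nct ncs ct cs ets ps pt sub.
have est : size s = size t by rewrite (perm_enum_size ps) (perm_enum_size pt).
have /(matched_rev est)/(_ 1%N isT) := m.
case: t pt est {sub m} => // f t pt _; rewrite /prefix_blocks /= !take0 => eC.
have ft : f \in sigma by rewrite -(perm_enum_mem pt) mem_head.
suff -> : e = f by [].
have [e2 f2] := (nchf_hypergraph nct et, nchf_hypergraph ncs ft).
apply/eqP; rewrite finset.eqEsubset (components1_sub e2 eC).
exact: (components1_sub f2 (esym eC)).
Qed.

Lemma Sphere_inj tau sigma : nchf tau -> nchf sigma ->
  connected_hypergraph tau -> connected_hypergraph sigma -> #|tau| = #|sigma| ->
  Sphere p tau = Sphere p sigma -> tau = sigma.
Proof.
move=> nct ncs ct cs ets eS; apply/eqP.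
by rewrite finset.eqEsubset (Sphere_sub nct ncs) ?(Sphere_sub ncs nct).
Qed.

End Complexes.

(** * Double counting *)

(** If an injection of [H] into itself reverses the relation, each element has at
    most as many successors as predecessors; since the totals agree, the numbers
    are equal. *)
Lemma card_reversed_rel (T : finType) (H : {set T}) (r : rel T) (h : T -> T) :
  {in H &, injective h} -> {in H, forall x, h x \in H} ->
  {in H &, forall x y, r x y -> r (h y) x} ->
  {in H, forall x, #|[set y in H | r x y]%SET| = #|[set y in H | r y x]%SET|}.
Proof.
move=> injh hH rh.
pose out x := #|[set y in H | r x y]%SET|; pose inn x := #|[set y in H | r y x]%SET|.
have le x : x \in H -> (out x <= inn x)%N.
  move=> xH; rewrite /out -(card_in_imset (f := h)); last first.
    by move=> y z; rewrite !inE => /andP[yH _] /andP[zH _]; apply: injh.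
  apply/subset_leq_card/fintype.subsetP=> _ /imsetP[y + ->]; rewrite !inE.
  by move=> /andP[yH xy]; rewrite hH //= rh.
have total : (\sum_(x in H) out x = \sum_(x in H) inn x)%N.
  have cardE x (Q : rel T) : #|[set y in H | Q x y]%SET| = (\sum_(y in H | Q x y) 1)%N.
    by rewrite -sum1_card; apply: eq_bigl => y; rewrite inE.
  rewrite (eq_bigr _ (fun x _ => cardE x r)).
  rewrite (eq_bigr _ (fun x _ => cardE x (fun u v => r v u))).
  rewrite (exchange_big_dep (mem H)) /= => [|x y _ /andP[]//].
  by apply: eq_bigr => y yH; apply: eq_bigl => x; rewrite yH.
move=> x xH; apply/eqP; rewrite eqn_leq le //= leqNgt; apply/negP=> lt.
have : (\sum_(y in H) out y < \sum_(y in H) inn y)%N.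
  rewrite (bigD1 x) // [X in (_ < X)%N](bigD1 x) //= -addSn leq_add //.
  by apply: leq_sum => y /andP[yH _]; apply: le.
by rewrite total ltnn.
Qed.

Lemma set_bij_card (T : finType) (A B : {set T}) : #|A| = #|B| ->
  exists h : T -> T, set_bij [set` A]%classic [set` B]%classic h.
Proof.
move=> eAB; pose h x := nth x (enum B) (index x (enum A)).
have hE x i : i < #|B| -> nth x (enum B) i \in B.
  by move=> lti; rewrite -mem_enum mem_nth // -cardE.
have lt x : x \in A -> (index x (enum A) < #|B|)%N.
  by move=> xA; rewrite -eAB cardE index_mem mem_enum.
exists h; split.
- by move=> x /= xA; apply: hE; apply: lt.
- move=> x y; rewrite !inE /= => xA yA; rewrite /h (set_nth_default x) -?cardE ?lt //.
  move/eqP; rewrite nth_uniq ?enum_uniq -?cardE ?lt // => /eqP.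
  by move/(congr1 (nth x (enum A))); rewrite !nth_index ?mem_enum.
move=> y /= yB.
have ltA : (index y (enum B) < size (enum A))%N.
  by rewrite -cardE eAB cardE index_mem mem_enum.
pose x := nth y (enum A) (index y (enum B)).
have xA : x \in A by rewrite -mem_enum mem_nth.
exists x => //; rewrite /h index_uniq ?enum_uniq //.
by rewrite (set_nth_default y) ?nth_index ?mem_enum // -cardE -eAB cardE.
Qed.

Section Counting.
Variables (R : realType) (n : nat) (p : 'I_n.+1 -> 'rV[R]_2).
Hypotheses (n2 : (2 <= n)%N) (pconv : convex_polygon p).
Implicit Types (tau sigma : {set {set 'I_n.+1}}).

Definition nc_hypertrees (k : nat) : {set {set {set 'I_n.+1}}} :=
  [set sigma | `[< nc_hypertree p sigma >] & #|sigma| == k]%SET.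

Lemma nc_hypertreesP k sigma : sigma \in nc_hypertrees k <->
  [/\ nchf sigma, connected_hypergraph sigma & #|sigma| = k].
Proof.
rewrite inE; split=> [/andP[/asboolP/(nc_hypertreeP n2 pconv)[ncs cs] /eqP]|[ncs cs ->]] //.
by rewrite eqxx andbT; apply/asboolP/(nc_hypertreeP n2 pconv).
Qed.

Lemma exists_opposite_map : exists h : {set {set 'I_n.+1}} -> {set {set 'I_n.+1}},
  forall sigma, nchf sigma -> [/\ nchf (h sigma), #|h sigma| = #|sigma|,
    conn (h sigma) =2 conn sigma & opposite sigma (h sigma)].
Proof.
have /choice[h hP] : forall sigma : {set {set 'I_n.+1}}, exists tau, nchf sigma ->
    [/\ nchf tau, #|tau| = #|sigma|, conn tau =2 conn sigma & opposite sigma tau].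
  move=> sigma; have [/exists_opposite[tau tauP]|] := pselect (nchf sigma).
    by exists tau.
  by exists sigma.
by exists h.
Qed.

Lemma card_spheres_simplices k tau : tau \in nc_hypertrees k ->
  #|[set sigma in nc_hypertrees k | Simplex p tau \subset Sphere p sigma]%SET| =
  #|[set sigma in nc_hypertrees k | Simplex p sigma \subset Sphere p tau]%SET|.
Proof.
have [h hP] := exists_opposite_map.
apply: (card_reversed_rel (r := fun s t => Simplex p s \subset Sphere p t) (h := h)).
- move=> s t /nc_hypertreesP[ncs _ cs] /nc_hypertreesP[nct _ ct] est.
  have [[nch ch _ os] [_ ch' _ ot]] := (hP s ncs, hP t nct).
  apply: opposite_inj ncs nct nch ch _ os _; rewrite est //.
- move=> s /nc_hypertreesP[ncs cs ks]; have [nch ch eh _] := hP s ncs.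
  apply/nc_hypertreesP; split=> //; last by rewrite ch.
  move=> x y; have := eh x y; rewrite /conn => ->; exact: cs.
move=> t s /nc_hypertreesP[nct ct kt] /nc_hypertreesP[ncs cs ks].
have [nch ch eh oh] := hP s ncs.
have cth : connected_hypergraph (h s).
  by move=> x y; have := eh x y; rewrite /conn => ->; exact: cs.
move/(sub_SphereP n2 pconv nct ncs ct cs); rewrite kt ks => /(_ erefl) R1.
apply/(sub_SphereP n2 pconv nch nct cth ct); first by rewrite ch ks kt.
by apply: (opposite_in_sphere nct ncs) R1 oh; rewrite ?ch ks.
Qed.

End Counting.

Theorem theoremC (R : realType) (n : nat) (p : 'I_n.+1 -> 'rV[R]_2)
    (tau : {set {set 'I_n.+1}}) :
  (2 <= n)%N -> convex_polygon p -> nc_hypertree p tau ->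
  (exists f : complex n -> complex n,
     set_bij
       [set S : complex n | [/\ exists2 sigma, nc_hypertree p sigma
                                             & S = Sphere p sigma,
                                Simplex p tau \subset S
                              & dimension (Simplex p tau) = dimension S]]%classic
       [set T : complex n | [/\ exists2 sigma, nc_hypertree p sigma
                                             & T = Simplex p sigma,
                                T \subset Sphere p tau
                              & dimension T = dimension (Sphere p tau)]]%classic
       f) /\
  (nc_tree p tau ->
   exists g : {set {set 'I_n.+1}} -> {set {set 'I_n.+1}},
     set_bij
       [set sigma | nc_tree p sigma /\ Simplex p tau \subset Sphere p sigma]%classic
       [set sigma | nc_tree p sigma /\ Simplex p sigma \subset Sphere p tau]%classic
       g).
Proof.
move=> n2 pconv /(nc_hypertreeP n2 pconv)[nct ct].
have hP := nc_hypertreesP n2 pconv.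
have tauH : tau \in nc_hypertrees p #|tau| by apply/hP.
have card_eq := card_spheres_simplices n2 pconv tauH.
split.
  pose A := [set sigma in nc_hypertrees p #|tau| | Simplex p tau \subset Sphere p sigma]%SET.
  pose B := [set sigma in nc_hypertrees p #|tau| | Simplex p sigma \subset Sphere p tau]%SET.
  have cardAB : #|(Sphere p @: A)%SET| = #|(Simplex p @: B)%SET|.
    rewrite !card_in_imset; first exact: card_eq.
      move=> s t /finset.setIdP[/hP[ncs cs es] _] /finset.setIdP[/hP[nc_t c_t et] _].
      by apply: (Simplex_inj n2 pconv) => //; rewrite es.
    move=> s t /finset.setIdP[/hP[ncs cs es] _] /finset.setIdP[/hP[nc_t c_t et] _].
    by apply: (Sphere_inj n2 pconv) => //; rewrite es.
  have [f fP] := set_bij_card cardAB; exists f.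
  suff [-> ->] : [set S : complex n | [/\ exists2 sigma, nc_hypertree p sigma
                                             & S = Sphere p sigma,
                                Simplex p tau \subset S
                              & dimension (Simplex p tau) = dimension S]]%classic =
       [set` (Sphere p @: A)%SET]%classic /\
       [set T : complex n | [/\ exists2 sigma, nc_hypertree p sigma
                                             & T = Simplex p sigma,
                                T \subset Sphere p tau
                              & dimension T = dimension (Sphere p tau)]]%classic =
       [set` (Simplex p @: B)%SET]%classic by [].
  split; apply/seteqP; split=> K /=.
  - case=> -[s /(nc_hypertreeP n2 pconv)[ncs cs] ->] sub.
    rewrite dimension_Simplex // dimension_Sphere // => /(eq_dimension n2 ct cs) ets.
    by apply: imset_f; apply/finset.setIdP; split=> //; apply/hP.
  - case/imsetP=> s /finset.setIdP[/hP[ncs cs es] sub] ->; split=> //.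
      by exists s => //; apply/(nc_hypertreeP n2 pconv).
    by rewrite dimension_Simplex // dimension_Sphere // es.
  - case=> -[s /(nc_hypertreeP n2 pconv)[ncs cs] ->] sub.
    rewrite dimension_Simplex // dimension_Sphere // => /(eq_dimension n2 cs ct) ets.
    by apply: imset_f; apply/finset.setIdP; split=> //; apply/hP.
  case/imsetP=> s /finset.setIdP[/hP[ncs cs es] sub] ->; split=> //.
    by exists s => //; apply/(nc_hypertreeP n2 pconv).
  by rewrite dimension_Simplex // dimension_Sphere // es.
case=> /tree_card[_ tn] _.
have [g gP] := set_bij_card card_eq; exists g.
have treeP sigma : nc_tree p sigma <-> sigma \in nc_hypertrees p #|tau|.
  rewrite tn; split=> [[/tree_card[hs es] ncs]|].
    by rewrite inE es eqxx andbT; apply/asboolP.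
  rewrite inE => /andP[/asboolP[hs ncs] /eqP es].
  by split=> //; apply/tree_card.
suff [-> ->] : [set sigma | nc_tree p sigma /\ Simplex p tau \subset Sphere p sigma]%classic =
    [set` [set sigma in nc_hypertrees p #|tau| | Simplex p tau \subset Sphere p sigma]%SET]%classic /\
    [set sigma | nc_tree p sigma /\ Simplex p sigma \subset Sphere p tau]%classic =
    [set` [set sigma in nc_hypertrees p #|tau| | Simplex p sigma \subset Sphere p tau]%SET]%classic by [].
split; apply/seteqP; split=> s /=.
- by case=> /treeP sH sub; apply/finset.setIdP.
- by case/finset.setIdP=> /treeP.
- by case=> /treeP sH sub; apply/finset.setIdP.
by case/finset.setIdP=> /treeP.
Qed.
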